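(* Let $d\ge1$ be an integer, let $\Lambda\subset\mathbb{R}^d$ be a bounded Borel set, and let $K$ be the kernel of a locally trace class orthogonal projection $\mathcal{K}$ on $L^2(\mathbb{R}^d,dx)$ such that the corresponding determinantal point process is hyperuniform along $\{R\Lambda\}_{R>0}$. Assume that $K(x,x)=1$ for almost all $x\in\mathbb{R}^d$. For $R>0$ let $\rho_{R\Lambda}$ be the accumulated spectrogram associated to $(\mathcal{K},R\Lambda)$. Then $$\rho_{R\Lambda}(R\,\cdot)\longrightarrow\mathbf{1}_\Lambda\quad\text{in }L^1(\mathbb{R}^d,dx)\text{ as }R\to+\infty.$$
   Context: Setting. $L^2(\mathbb{R}^d,dx)$ is the complex Hilbert space (Lebesgue measure) with inner product $\langle f,g\rangle=\int f\overline{g}\,dx$. For a bounded Borel set $\Lambda\subset\mathbb{R}^d$, $\mathcal{P}_\Lambda f=\mathbf{1}_\Lambda f$, and $R\Lambda=\{Rx:x\in\Lambda\}$. An operator $\mathcal{K}$ is locally trace class if $\mathcal{P}_\Lambda\mathcal{K}\mathcal{P}_\Lambda$ is trace class for every bounded Borel $\Lambda$; it then has a kernel $K$, i.e. $\mathcal{K}f(x)=\int K(x,y)f(y)\,dy$. If $\mathcal{K}$ is a locally trace class orthogonal projection onto a closed subspace $L$, fix a Borel set $S_0\subset\mathbb{R}^d$ of full Lebesgue measure on which all functions of $L$ are defined pointwise; the kernel and the pointwise values are taken so that, writing $K_x(y)=K(y,x)$, one has $K_x\in L$ and $f(x)=\langle f,K_x\rangle$ for all $f\in L$, $x\in S_0$.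 In particular $K(x,y)=\overline{K(y,x)}$ and $\int K(x,y)K(y,z)\,dy=K(x,z)$ on $S_0$. Accumulated spectrogram. For a bounded Borel set $\Lambda$, let $\mathcal{M}_\Lambda=\mathcal{P}_\Lambda\mathcal{K}\mathcal{P}_\Lambda$, with spectral decomposition $\mathcal{M}_\Lambda f=\sum_{j\ge1}\mu_j^{(\Lambda)}\langle f,\Phi_j^{(\Lambda)}\rangle\Phi_j^{(\Lambda)}$, where $1\ge\mu_1^{(\Lambda)}\ge\mu_2^{(\Lambda)}\ge\dots\ge0$ are the eigenvalues counted with multiplicity and the $\Phi_j^{(\Lambda)}$ are corresponding orthonormal eigenfunctions. Let $\mathcal{N}_\Lambda=\mathcal{K}\mathcal{P}_\Lambda$, with polar decomposition $\mathcal{N}_\Lambda=\mathcal{W}_\Lambda\sqrt{\mathcal{M}_\Lambda}$, where $\mathcal{W}_\Lambda(\sqrt{\mathcal{M}_\Lambda}f)=\mathcal{N}_\Lambda f$ (extended by continuity to the closure of the range) and $\mathcal{W}_\Lambda=0$ on $\ker\mathcal{M}_\Lambda=\ker\mathcal{N}_\Lambda$. Put $\Psi_j^{(\Lambda)}=\mathcal{W}_\Lambda\Phi_j^{(\Lambda)}\in L$. Let $N_\Lambda$ be the upper integer part (ceiling) of $\mathrm{Tr}(\mathcal{M}_\Lambda)$. The accumulated spectrogram associated to $(\mathcal{K},\Lambda)$ is $\rho_\Lambda(x)=\sum_{j=1}^{N_\Lambda}|\Psi_j^{(\Lambda)}(x)|^2$, $x\in S_0$. Any fixed choice of eigenfunctions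 is allowed. Point processes. A configuration $\Xi$ is a non-negative-integer-valued Radon measure on $\mathbb{R}^d$; it is simple if $\Xi(\{x\})\in\{0,1\}$ for all $x$. A simple point process $\mathbb{P}$ is a probability measure on the space of configurations supported on simple ones; $\mathbb{E}$ and $\mathrm{var}$ are taken under $\mathbb{P}$. The $n$-th correlation function $\rho_n$ is defined by $\mathbb{E}\big[\sum^*_{x_1,\dots,x_n\in\mathrm{supp}\,\Xi}f(x_1,\dots,x_n)\big]=\int f\rho_n\,dx_1\cdots dx_n$ for all measurable compactly supported $f$, the sum being over pairwise distinct points. The determinantal point process associated to $\mathcal{K}$ is the simple point process with $\rho_n(x_1,\dots,x_n)=\det(K(x_i,x_j))_{i,j=1}^n$ for all $n$; it is known to exist for every locally trace class orthogonal projection. It is hyperuniform along $\{R\Lambda\}_{R>0}$ if $\mathbb{E}[\Xi(R\Lambda)]\to\infty$ and $\mathrm{var}(\Xi(R\Lambda))/\mathbb{E}[\Xi(R\Lambda)]\to0$ as $R\to+\infty$. *)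

(* Defs.v *)
From HB Require Import structures.
From mathcomp Require Import all_boot all_order all_algebra.
From mathcomp Require Import complex.
From mathcomp Require Import all_classical all_reals all_analysis.
From mathcomp Require Import measurable_realfun.

Set Implicit Arguments.
Unset Strict Implicit.
Unset Printing Implicit Defensive.

Import Order.TTheory GRing.Theory Num.Theory.
Import numFieldNormedType.Exports.

Local Open Scope classical_set_scope.
Local Open Scope ring_scope.

(* The n-fold product m ⊗ ... ⊗ m of a sigma-finite measure, on n-tuples. *)

Definition cons_pair (T : Type) (n : nat) (p : T * n.-tuple T) : n.+1.-tuple T :=
  [tuple of p.1 :: p.2].

Lemma measurable_cons_pair (disp : measure_display) (T : measurableType disp)
    (n : nat) : measurable_fun [set: T * n.-tuple T] (@cons_pair T n).
Proof. by apply: measurable_cons. Qed.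

Section tuple_measure_succ.
Context {disp : measure_display} {T : measurableType disp} {R : realType}.
Context (m : {sigma_finite_measure set T -> \bar R}) (n : nat).
Context (mn : {sigma_finite_measure set (n.-tuple T) -> \bar R}).

Definition tuple_measure_succ : set (n.+1.-tuple T) -> \bar R :=
  pushforward (m \x mn)%E (@cons_pair T n).

Let ms0 : tuple_measure_succ set0 = 0%E.
Proof. by rewrite /tuple_measure_succ /pushforward preimage_set0 measure0. Qed.

Let ms_ge0 A : (0 <= tuple_measure_succ A)%E.
Proof. by rewrite /tuple_measure_succ /pushforward measure_ge0. Qed.

Let ms_sigma_additive : semi_sigma_additive tuple_measure_succ.
Proof.
have mc : measurable_fun [set: T * n.-tuple T] (@cons_pair T n).
  exact: measurable_cons_pair.
move=> F mF tF mUF; rewrite /tuple_measure_succ /pushforward preimage_bigcup.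
apply: measure_semi_sigma_additive.
- by move=> k; rewrite -[X in measurable X]setTI; exact: mc.
- apply/trivIsetP => /= i j _ _ ij; rewrite -preimage_setI.
  by move/trivIsetP : tF => /(_ _ _ _ _ ij) ->//; rewrite preimage_set0.
- by rewrite -preimage_bigcup -[X in measurable X]setTI; exact: mc.
Qed.

HB.instance Definition _ := isMeasure.Build _ _ _ tuple_measure_succ
  ms0 ms_ge0 ms_sigma_additive.

Let ms_sigma_finite : sigma_finite setT tuple_measure_succ.
Proof.
have /sigma_finiteP[F [TF ndF Foo]] := sigma_finiteT m.
have /sigma_finiteP[G [TG ndG Goo]] := sigma_finiteT mn.
have mh : measurable_fun [set: n.+1.-tuple T] (@thead n T).
  exact: measurable_tnth.
have mb : measurable_fun [set: n.+1.-tuple T]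
    (fun x => [tuple of behead x] : n.-tuple T).
  exact: measurable_behead.
exists (fun k => [set x : n.+1.-tuple T | F k (thead x) /\
                     G k ([tuple of behead x] : n.-tuple T)]).
  apply/seteqP; split=> // x _.
  have [k _ Fk] : (\bigcup_i F i) (thead x) by rewrite -TF.
  have [l _ Gl] : (\bigcup_i G i) ([tuple of behead x] : n.-tuple T).
    by rewrite -TG.
  exists (maxn k l) => //; split.
    by move: (thead x) Fk; exact/subsetPset/ndF/leq_maxl.
  by move: ([tuple of behead x] : n.-tuple T) Gl; exact/subsetPset/ndG/leq_maxr.
move=> k; have [mF Fo] := Foo k; have [mG Go] := Goo k; split.
  have -> : [set x : n.+1.-tuple T | F k (thead x) /\
                     G k ([tuple of behead x] : n.-tuple T)] =
    ((@thead n T) @^-1` F k) `&`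
    ((fun x : n.+1.-tuple T => [tuple of behead x] : n.-tuple T) @^-1` G k).
    by [].
  by apply: measurableI; rewrite -[X in measurable X]setTI; [exact: mh|exact: mb].
rewrite /tuple_measure_succ /pushforward.
have -> : (@cons_pair T n) @^-1` [set x : n.+1.-tuple T | F k (thead x) /\
                     G k ([tuple of behead x] : n.-tuple T)] = F k `*` G k.
  apply/seteqP; split => -[x y] /=; rewrite /cons_pair theadE /=.
    have -> : [tuple of behead [tuple of x :: y]] = y by exact: val_inj.
    by [].
  by have -> : [tuple of behead [tuple of x :: y]] = y by exact: val_inj.
by rewrite product_measure1E// lte_mul_pinfty// ge0_fin_numE.
Qed.

HB.instance Definition _ := Measure_isSigmaFinite.Build _ _ _ tuple_measure_succ
  ms_sigma_finite.

End tuple_measure_succ.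

Fixpoint tuple_measure (disp : measure_display) (T : measurableType disp)
    (R : realType) (m : {sigma_finite_measure set T -> \bar R}) (n : nat) :
    {sigma_finite_measure set (n.-tuple T) -> \bar R} :=
  match n with
  | 0 => \d_([tuple] : 0.-tuple T)
  | k.+1 => tuple_measure_succ m (tuple_measure m k)
  end.

(* [measurableTypeR R] rather than [R], so that the sigma-algebra generated by
   the coordinates is the Borel one and carries [lebesgue_measure]. *)
Notation euclid R d := (d.-tuple (measurableTypeR R)).

Definition leb (R : realType) (d : nat) :
    {sigma_finite_measure set (euclid R d) -> \bar R} :=
  tuple_measure (@lebesgue_measure R) d.

Definition scale (R : realType) (d : nat) (r : R) (x : euclid R d) : euclid R d :=
  [tuple r * tnth x i | i < d].

Definition dilate (R : realType) (d : nat) (r : R) (A : set (euclid R d)) :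
    set (euclid R d) :=
  scale r @` A.

Definition bounded_subset (R : realType) (d : nat) (A : set (euclid R d)) : Prop :=
  exists M : R, forall x, A x -> forall i, `|tnth x i| <= M.

Definition cube (R : realType) (d : nat) (x : euclid R d) (e : R) :
    set (euclid R d) :=
  [set y | forall i, `|tnth y i - tnth x i| < e].

(* The complex Hilbert space L^2(R^d). Its elements are represented by functions
   [euclid R d -> R[i]], identified when they agree almost everywhere; operators
   are maps on representatives that are compatible with this identification. *)

Definition cmeasurable (disp : measure_display) (T : measurableType disp)
    (R : realType) (f : T -> R[i]) : Prop :=
  measurable_fun setT (fun x => complex.Re (f x)) /\
  measurable_fun setT (fun x => complex.Im (f x)).

Definition cintegral (R : realType) (d : nat) (f : euclid R d -> R[i]) : R[i] :=
  (\int[leb R d]_x complex.Re (f x) +i* \int[leb R d]_x complex.Im (f x))%C.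

Definition L2norm (R : realType) (d : nat) (f : euclid R d -> R[i]) : \bar R :=
  Lnorm (leb R d) 2%:E (fun x => (Normc.normc (f x))%:E).

Definition L2 (R : realType) (d : nat) : set (euclid R d -> R[i]) :=
  [set f | cmeasurable f /\ (L2norm f < +oo)%E].

Definition inner (R : realType) (d : nat) (f g : euclid R d -> R[i]) : R[i] :=
  cintegral (fun x => f x * (g x)^*%C).

Definition complex_cvg (R : realType) (u : nat -> R[i]) (z : R[i]) : Prop :=
  (fun n => complex.Re (u n)) @ \oo --> complex.Re z /\
  (fun n => complex.Im (u n)) @ \oo --> complex.Im z.

Notation operator R d := ((euclid R d -> R[i]) -> (euclid R d -> R[i])).

Record bounded_operator (R : realType) (d : nat) (T : operator R d) : Prop := {
  operator_L2 : forall f, L2 f -> L2 (T f);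
  operator_ae : forall f g, L2 f -> L2 g ->
    f = g %[ae leb R d] -> T f = T g %[ae leb R d];
  operator_linear : forall (a : R[i]) f g, L2 f -> L2 g ->
    T (fun x => a * f x + g x) = (fun x => a * T f x + T g x) %[ae leb R d];
  operator_bounded : exists c : R, forall f, L2 f ->
    (L2norm (T f) <= c%:E * L2norm f)%E }.

Definition adjoint (R : realType) (d : nat) (T T' : operator R d) : Prop :=
  bounded_operator T' /\
  forall f g, L2 f -> L2 g -> inner (T f) g = inner f (T' g).

(* The order of [R[i]] makes [0 <= z] mean that z is real and nonnegative. *)
Definition positive_operator (R : realType) (d : nat) (A : operator R d) : Prop :=
  bounded_operator A /\ forall f, L2 f -> 0 <= inner (A f) f.

Definition is_sqrt (R : realType) (d : nat) (A S : operator R d) : Prop :=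
  positive_operator S /\ forall f, L2 f -> S (S f) = A f %[ae leb R d].

Definition is_abs (R : realType) (d : nat) (T A : operator R d) : Prop :=
  exists2 T', adjoint T T' & is_sqrt (T' \o T) A.

Definition orthonormal (R : realType) (d : nat)
    (e : nat -> euclid R d -> R[i]) : Prop :=
  (forall n, L2 (e n)) /\ forall m n, inner (e m) (e n) = (m == n)%:R.

Definition orthonormal_basis (R : realType) (d : nat)
    (e : nat -> euclid R d -> R[i]) : Prop :=
  orthonormal e /\
  forall f, L2 f -> (forall n, inner f (e n) = 0) -> f = cst 0 %[ae leb R d].

Definition trace_class (R : realType) (d : nat) (T : operator R d) : Prop :=
  bounded_operator T /\
  exists2 A, is_abs T A &
    exists2 e, orthonormal_basis e &
      (\sum_(0 <= k <oo) (complex.Re (inner (A (e k)) (e k)))%:E < +oo)%E.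

(* For a trace class operator the value t does not depend on the basis. *)
Definition is_trace (R : realType) (d : nat) (T : operator R d) (t : R[i]) : Prop :=
  exists2 e, orthonormal_basis e &
    complex_cvg (fun n => \sum_(k < n) inner (T (e k)) (e k)) t.

Definition cutoff (R : realType) (d : nat) (A : set (euclid R d)) : operator R d :=
  fun f x => (\1_A x)%:C%C * f x.

Definition locally_trace_class (R : realType) (d : nat) (T : operator R d) : Prop :=
  forall A : set (euclid R d), measurable A -> bounded_subset A ->
    trace_class (cutoff A \o T \o cutoff A).

(* L is a set of pointwise defined functions: the closed subspace consists of
   their classes. *)
Record closed_subspace (R : realType) (d : nat) (L : set (euclid R d -> R[i])) :
    Prop := {
  subspace_L2 : L `<=` @L2 R d;
  subspace_0 : L (cst 0);
  subspace_linear : forall (a : R[i]) f g, L f -> L g -> L (fun x => a * f x + g x);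
  subspace_closed : forall (u : nat -> euclid R d -> R[i]) f,
    (forall n, L (u n)) -> L2 f ->
    (fun n => L2norm (fun x => u n x - f x)) @ \oo --> 0%E ->
    exists2 g, L g & f = g %[ae leb R d] }.

Definition orthogonal_projection (R : realType) (d : nat) (Kop : operator R d)
    (L : set (euclid R d -> R[i])) : Prop :=
  bounded_operator Kop /\ closed_subspace L /\
  forall f, L2 f ->
    (exists2 g, L g & Kop f = g %[ae leb R d]) /\
    (forall g, L g -> inner (fun x => f x - Kop f x) g = 0).

(* K is the kernel of the projection Kop onto L. Functions are total for
   convenience only: their values outside the full measure set S0 are arbitrary
   and play no role. *)
Record projection_kernel (R : realType) (d : nat) (Kop : operator R d)
    (L : set (euclid R d -> R[i])) (S0 : set (euclid R d))
    (K : euclid R d -> euclid R d -> R[i]) : Prop := {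
  kernel_measurable : cmeasurable (fun p : euclid R d * euclid R d => K p.1 p.2);
  kernel_domain : measurable S0 /\ leb R d (~` S0) = 0%E;
  kernel_integral : forall f, L2 f ->
    Kop f = (fun x => cintegral (fun y => K x y * f y)) %[ae leb R d];
  kernel_section : forall x, S0 x -> L (fun y => K y x);
  kernel_reproducing : forall f x, L f -> S0 x -> f x = inner f (fun y => K y x) }.

(* The accumulated spectrogram. *)

Definition concentration (R : realType) (d : nat) (Kop : operator R d)
    (A : set (euclid R d)) : operator R d :=
  cutoff A \o Kop \o cutoff A.

Record spectral_decomposition (R : realType) (d : nat) (T : operator R d)
    (mu : nat -> R) (Phi : nat -> euclid R d -> R[i]) : Prop := {
  spectral_orthonormal : orthonormal Phi;
  spectral_eigen : forall j,
    T (Phi j) = (fun x => (mu j)%:C%C * Phi j x) %[ae leb R d];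
  spectral_noninc : forall j, mu j.+1 <= mu j;
  spectral_range : forall j, 0 <= mu j <= 1;
  spectral_expansion : forall f, L2 f ->
    (fun n => L2norm (fun x => T f x -
       \sum_(j < n) (mu j)%:C%C * inner f (Phi j) * Phi j x)) @ \oo --> 0%E }.

(* N = W \o sqrt M. Boundedness of W expresses the extension by continuity to the
   closure of the range of sqrt M. *)
Definition polar_decomposition (R : realType) (d : nat) (N M W : operator R d) :
    Prop :=
  [/\ bounded_operator W,
      exists2 S, is_sqrt M S & forall f, L2 f -> W (S f) = N f %[ae leb R d]
    & forall f, L2 f -> M f = cst 0 %[ae leb R d] -> W f = cst 0 %[ae leb R d]].

(* [Psi j] is the representative in L, with its pointwise values, of the class
   of [W (Phi j)]. *)
Definition acc_spectrogram (R : realType) (d : nat) (Kop : operator R d)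
    (L : set (euclid R d -> R[i])) (A : set (euclid R d)) (rho : euclid R d -> R) :
    Prop :=
  exists (mu : nat -> R) (Phi Psi : nat -> euclid R d -> R[i]) (W : operator R d)
      (t : R) (N : nat),
    [/\ spectral_decomposition (concentration Kop A) mu Phi,
        polar_decomposition (Kop \o cutoff A) (concentration Kop A) W,
        forall j, L (Psi j) /\ Psi j = W (Phi j) %[ae leb R d],
        is_trace (concentration Kop A) t%:C%C /\ N%:Z = Num.ceil t
      & forall x, rho x = \sum_(j < N) Normc.normc (Psi j x) ^+ 2].

(* Point processes. Bounded sets having finite integer mass, a configuration is
   a Radon measure, and takes values in N or +oo on arbitrary Borel sets. *)

Record config (R : realType) (d : nat) := Config {
  config_measure :> {measure set (euclid R d) -> \bar R};
  config_nat : forall B, measurable B -> bounded_subset B ->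
    exists k : nat, config_measure B = k%:R%:E }.

Lemma config0_nat (R : realType) (d : nat) (B : set (euclid R d)) :
  measurable B -> bounded_subset B -> exists k : nat, @mzero _ (euclid R d) R B = k%:R%:E.
Proof. by move=> _ _; exists 0%N. Qed.

HB.instance Definition _ (R : realType) (d : nat) := gen_eqMixin (config R d).
HB.instance Definition _ (R : realType) (d : nat) := gen_choiceMixin (config R d).
HB.instance Definition _ (R : realType) (d : nat) :=
  isPointed.Build (config R d) (Config (@config0_nat R d)).

(* The sigma-algebra generated by the counting maps Xi |-> Xi(B). *)
Definition counting_cylinder (R : realType) (d : nat) : set (set (config R d)) :=
  [set E | exists B : set (euclid R d), measurable B /\
    exists2 Y : set (\bar R), measurable Y & E = [set Xi : config R d | Y (Xi B)]].

Definition config_display : measure_display.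
Proof. exact: default_measure_display. Qed.

HB.instance Definition _ (R : realType) (d : nat) :=
  @isMeasurable.Build config_display (config R d) <<s @counting_cylinder R d >>
    (@sigma_algebra0 _ setT _) (@sigma_algebraC _ _) (@sigma_algebra_bigcup _ setT _).

Definition simple_config (R : realType) (d : nat) (Xi : config R d) : Prop :=
  forall x, Xi [set x] = 0%E \/ Xi [set x] = 1%E.

Definition simple_process (R : realType) (d : nat) (P : probability (config R d) R) :
    Prop :=
  {ae P, forall Xi, simple_config Xi}.

Definition supp (R : realType) (d : nat) (Xi : config R d) : set (euclid R d) :=
  [set x | forall e, 0 < e -> (0 < Xi (cube x e))%E].

Definition distinct_points (R : realType) (d n : nat) (Xi : config R d) :
    set (n.-tuple (euclid R d)) :=
  [set x : n.-tuple (euclid R d) | uniq x /\ forall i, supp Xi (tnth x i)].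

(* Test functions are taken nonnegative, so that both sides are defined in
   [0, +oo]; signed test functions are recovered by linearity. *)
Definition correlation_function (R : realType) (d n : nat)
    (P : probability (config R d) R) (rho : n.-tuple (euclid R d) -> R) : Prop :=
  forall f : n.-tuple (euclid R d) -> R,
    measurable_fun setT f -> (forall x, 0 <= f x) ->
    (exists2 B, bounded_subset B &
       forall x, (exists i, ~ B (tnth x i)) -> f x = 0) ->
    (\int[P]_Xi (\esum_(x in @distinct_points R d n Xi) (f x)%:E) =
     \int[tuple_measure (leb R d) n]_x (f x * rho x)%:E)%E.

(* The determinant is real at almost every point, since the kernel of a projection
   is Hermitian. *)
Definition determinantal_process (R : realType) (d : nat)
    (P : probability (config R d) R) (K : euclid R d -> euclid R d -> R[i]) : Prop :=
  simple_process P /\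
  forall n : nat, correlation_function P (fun x : n.-tuple (euclid R d) =>
    complex.Re (\det (\matrix_(i < n, j < n) K (tnth x i) (tnth x j)))).

Definition count_in (R : realType) (d : nat) (A : set (euclid R d)) (Xi : config R d) :
    R := fine (Xi A).

Definition hyperuniform (R : realType) (d : nat) (P : probability (config R d) R)
    (A : set (euclid R d)) : Prop :=
  ('E_P[count_in (dilate r A)])%E @[r --> +oo] --> +oo%E /\
  ('V_P[count_in (dilate r A)] / 'E_P[count_in (dilate r A)])%E @[r --> +oo] --> 0%E.

Definition cvg_in_L1 (R : realType) (d : nat) (F : R -> euclid R d -> R)
    (f : euclid R d -> R) : Prop :=
  [/\ forall r, 0 < r -> (leb R d).-integrable setT (fun x => (F r x)%:E),
      (leb R d).-integrable setT (fun x => (f x)%:E)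
    & Lnorm (leb R d) 1%:E (fun x => (F r x - f x)%:E) @[r --> +oo] --> 0%E].

(* Main.v *)
(* Write A for the dilated set, M for the concentration operator on A, T = |A| and
   Q for the integral of |K|^2 over A x A. The first two correlation functions give
   E[Xi(A)] = T and Var(Xi(A)) = T - Q, while Tr M = T and Tr M^2 = Q by Parseval.
   Since the eigenvalues lie in [0, 1] and T <= N, the N largest ones sum to at
   least Q. The functions Psi_j are orthonormal or null, lie in the reproducing
   kernel space L, and carry the mass mu_j on A; so 0 <= rho <= K(x,x) = 1 by Bessel,
   and the L^1 distance of rho to 1_A is
   T - 2 (mu_1 + ... + mu_N) + (integral of rho) <= 2 (T - Q) + 1,
   using N <= T + 1. After rescaling, division by r^d turns this bound into a
   multiple of Var/E + 1/E, which tends to 0 by hyperuniformity. *)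

Require Import Defs.
From HB Require Import structures.
From mathcomp Require Import all_boot all_order all_algebra.
From mathcomp Require Import complex.
From mathcomp Require Import all_classical all_reals all_analysis.
From mathcomp Require Import measurable_realfun.
From mathcomp Require Import ring lra.
Import Order.TTheory GRing.Theory Num.Theory.
Import numFieldNormedType.Exports.
Local Open Scope classical_set_scope.
Local Open Scope ring_scope.
Set Implicit Arguments.
Unset Strict Implicit.
Unset Printing Implicit Defensive.

(** * Lebesgue measure on tuples *)

(** The eigenfunctions [Phi j] are orthonormal but need not be complete, so both traces are computed
    along the orthonormal basis [e] that witnesses the trace. At almost every x, K(1_A e_k)(x) =
    <e_k, 1_A K_x>; Parseval at fixed x sums the squares over k to ||1_A K_x||^2, whose integral is
    T over the whole space and Q over A. The spectral expansion of each M e_k, followed by Parseval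
    for each [Phi j] in the basis [e], turns Q into the sum of the mu_j^2. A second constraint is
    that operators act on representatives up to null sets, whereas the bound rho <= 1 concerns
    pointwise values. The passage between the two is the reproducing property on [S0], applied to
    the representatives [Psi j] chosen in [L]. On the probabilistic side, the correlation functions
    see sums over the support; these become polynomials in Xi(A) because a simple configuration is,
    on bounded sets, the counting measure of its support. *)

Section tuple_measure_integral.
Context {disp : measure_display} {T : measurableType disp} {R : realType}.
Variable m : {sigma_finite_measure set T -> \bar R}.
Local Open Scope ereal_scope.

(** By construction the measure on n+1 coordinates is the image of a product measure, so a change of
    variables and Tonelli split off the first coordinate. *)
Lemma ge0_integral_tuple_succ (n : nat) (f : n.+1.-tuple T -> \bar R) :
  measurable_fun setT f -> (forall x, 0 <= f x) ->
  \int[tuple_measure m n.+1]_z f z =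
  \int[m]_x \int[tuple_measure m n]_y f [tuple of x :: y].
Proof.
move=> mf f0.
have mc : measurable_fun setT (@cons_pair T n) by exact: measurable_cons_pair.
rewrite /= [LHS](@ge0_integral_pushforward _ _ _ _ _ _ mc
  (m \x tuple_measure m n) setT f)// preimage_setT.
apply: (fubini_tonelli1 (f \o @cons_pair T n)) => [|x]; last exact: f0.
exact: (measurableT_comp mf mc).
Qed.

Lemma integral_tuple0 (f : 0.-tuple T -> \bar R) : measurable_fun setT f ->
  \int[tuple_measure m 0]_z f z = f [tuple].
Proof. by move=> mf; rewrite /= integral_dirac// diracT mul1e. Qed.

Lemma ge0_integral_tuple1 (f : T -> \bar R) : measurable_fun setT f ->
  (forall x, 0 <= f x) ->
  \int[tuple_measure m 1]_z f (tnth z ord0) = \int[m]_x f x.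
Proof.
move=> mf f0.
have mf1 : measurable_fun setT (fun z : 1.-tuple T => f (tnth z ord0)).
  exact: (measurableT_comp mf (measurable_tnth ord0)).
rewrite ge0_integral_tuple_succ//; apply: eq_integral => x _.
by rewrite integral_tuple0//; exact: (measurable_cst (f x)).
Qed.

Lemma ge0_integral_tuple2 (f : T * T -> \bar R) : measurable_fun setT f ->
  (forall x, 0 <= f x) ->
  \int[tuple_measure m 2]_z f (tnth z ord0, tnth z (lift ord0 ord0)) =
  \int[m]_x \int[m]_y f (x, y).
Proof.
move=> mf f0.
have mf1 : measurable_fun setT
    (fun z : 2.-tuple T => f (tnth z ord0, tnth z (lift ord0 ord0))).
  by apply: (measurableT_comp mf); apply: measurable_fun_pair;
    exact: measurable_tnth.
rewrite ge0_integral_tuple_succ//; apply: eq_integral => x _.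
rewrite -(@ge0_integral_tuple1 (fun y => f (x, y)))//.
  by apply: eq_integral => y _; rewrite !(tnth_nth x).
exact: (measurableT_comp mf (pair1_measurable x)).
Qed.
End tuple_measure_integral.

(** * Lebesgue measure under dilations *)

Section lebesgue_scaling.
Context {R : realType}.

(** The right-hand side is a measure that gives ]a, b] the mass r (b/r - a/r) = b - a, and Lebesgue
    measure is determined by its values on these intervals. *)
Lemma lebesgue_measure_scale (r : R) (A : set (measurableTypeR R)) :
  0 < r -> measurable A ->
  lebesgue_measure A =
  (r%:E * lebesgue_measure (( *%R r : measurableTypeR R -> measurableTypeR R) @^-1` A))%E.
Proof.
move=> r0 mA.
have mr : measurable_fun setT ( *%R r : measurableTypeR R -> measurableTypeR R).
  exact: mulrl_measurable.
pose k : {nonneg R} := NngNum (ltW r0).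
pose m := measure_function_pushforward__canonical__measure_function_Measure (@lebesgue_measure R) mr.
pose M : {measure set (measurableTypeR R) -> \bar R} := mscale k m.
rewrite -[RHS]/(M A).
apply: (@lebesgue_measure_unique R M) => // _ [[a b] _ <-] /=.
rewrite /mscale /= /pushforward /=.
rewrite (_ : _ @^-1` _ = `](a / r), (b / r)]%classic); last first.
  by apply/seteqP; split=> x /=; rewrite !in_itv /= ltr_pdivrMr// ler_pdivlMr// ![x * r]mulrC.
rewrite !lebesgue_measure_itv /= !lte_fin ltr_pM2r ?invr_gt0//.
case: ifPn => _; last by rewrite mule0.
by rewrite !EFinN -!EFinB -EFinM -mulrBl mulrCA mulfV ?gt_eqF// mulr1.
Qed.

Lemma ge0_integral_lebesgue_scale (r : R) (f : measurableTypeR R -> \bar R) :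
  0 < r -> measurable_fun setT f -> (forall x, 0 <= f x)%E ->
  (\int[@lebesgue_measure R]_x f (r * x)%R =
   r^-1%:E * \int[@lebesgue_measure R]_x f x)%E.
Proof.
move=> r0 mf f0.
have mr : measurable_fun setT ( *%R r : measurableTypeR R -> measurableTypeR R).
  exact: mulrl_measurable.
pose k : {nonneg R} := NngNum (ltW r0).
pose m := measure_function_pushforward__canonical__measure_function_Measure (@lebesgue_measure R) mr.
have -> : (\int[@lebesgue_measure R]_x f x = \int[mscale k m]_x f x)%E.
  by apply: eq_measure_integral => A mA _; exact: lebesgue_measure_scale.
rewrite ge0_integral_mscale// (ge0_integral_pushforward mr)//.
by rewrite preimage_setT muleA -EFinM mulVf ?gt_eqF// mul1e.
Qed.

Lemma measurable_scale (d : nat) (r : R) : measurable_fun setT (@scale R d r).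
Proof.
apply/measurable_fun_tnthP => i; rewrite (_ : _ \o _ = fun x => r * tnth x i).
  by apply: (@measurableT_comp _ _ _ _ _ _ ( *%R r : R -> R)); [exact: mulrl_measurable|exact: measurable_tnth].
by apply/funext => x /=; rewrite tnth_mktuple.
Qed.

Lemma scale_cons (d : nat) (r x : R) (y : euclid R d) :
  scale r [tuple of x :: y] = [tuple of r * x :: scale r y] :> euclid R d.+1.
Proof.
apply/eq_from_tnth => i; rewrite tnth_mktuple.
by case: (unliftP ord0 i) => [j|] ->; rewrite ?tnthS ?theadE// tnth_mktuple.
Qed.

(** By induction on d: Tonelli isolates one coordinate, and each coordinate contributes a factor
    r^-1. *)
Lemma ge0_integral_leb_scale (d : nat) (r : R) (f : euclid R d -> \bar R) :
  0 < r -> measurable_fun setT f -> (forall x, 0 <= f x)%E ->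
  (\int[leb R d]_x f (scale r x) = (r ^- d)%:E * \int[leb R d]_x f x)%E.
Proof.
move=> r0; elim: d f => [|d IH] f mf f0.
  rewrite !integral_tuple0//; last by apply: (measurableT_comp mf); exact: measurable_scale.
  rewrite expr0 invr1 mul1e; congr (f _); apply: eq_from_tnth; case=> //.
rewrite !ge0_integral_tuple_succ//; last by apply: (measurableT_comp mf); exact: measurable_scale.
have mF : measurable_fun setT (f \o @cons_pair _ d).
  by apply: (measurableT_comp mf); exact: measurable_cons_pair.
(* The inner integral as a function of the first coordinate, with the measurability that the
   one-dimensional scaling asks for. *)
have [g [gE g0 mg]] : exists g : measurableTypeR R -> \bar R,
    [/\ forall x, (g x = \int[leb R d]_y f [tuple of x :: y])%E,
       forall x, (0 <= g x)%E & measurable_fun setT g].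
  exists (fubini_F (leb R d) (f \o @cons_pair _ d)); split => //.
    by move=> x; apply: integral_ge0 => y _; exact: f0.
  by apply: measurable_fun_fubini_tonelli_F => // x; exact: f0.
transitivity (\int[lebesgue_measure]_x ((r ^- d)%:E * g (r * x)%R))%E.
  apply: eq_integral => x _; rewrite gE -IH//; last 1 first.
    exact: (measurableT_comp mF (pair1_measurable (r * x))).
  by apply: eq_integral => y _; rewrite scale_cons.
under [X in (_ * X)%E]eq_integral do rewrite -gE.
rewrite ge0_integralZl_EFin//; last 2 first.
- exact: (measurableT_comp mg (mulrl_measurable r)).
- by rewrite invr_ge0 exprn_ge0 ?ltW.
by rewrite (ge0_integral_lebesgue_scale r0 mg)// muleA -EFinM exprSr invfM mulrC.
Qed.

End lebesgue_scaling.

(** * Volumes of boxes, bounded sets and dilates *)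

Section leb_sets.
Context {R : realType}.

Lemma measurable_box d (M : R) :
  measurable [set x : euclid R d | forall i, `|tnth x i| <= M].
Proof.
rewrite (_ : [set _ | _] = \bigcap_(i in [set: 'I_d])
    ((fun x : euclid R d => tnth x i) @^-1` `[- M, M])); last first.
  apply/seteqP; split=> x /= h i.
    by move=> _ /=; rewrite in_itv /= -ler_norml.
  by have := h i I; rewrite /= in_itv /= -ler_norml.
apply: fin_bigcap_measurable => // i _.
by rewrite -[X in measurable X]setTI; apply: measurable_tnth.
Qed.

Lemma leb_box_lty d (M : R) :
  (leb R d [set x : euclid R d | forall i, (`|tnth x i| <= M)%R] < +oo)%E.
Proof.
elim: d => [|d IH]; first by rewrite /leb /= diracE; case: (_ \in _); rewrite ltry.
rewrite /leb /= /tuple_measure_succ /pushforward.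
rewrite (_ : _ @^-1` _ = (`[- M, M]%classic : set (measurableTypeR R)) `*`
   [set x : euclid R d | forall i, `|tnth x i| <= M]); last first.
  apply/seteqP; split=> -[x y] /=; rewrite in_itv /= -ler_norml.
    move=> h; split; first by have := h ord0; rewrite (tnth_nth x).
    by move=> i; have := h (lift ord0 i); rewrite tnthS.
  by move=> [hx hy] i; case: (unliftP ord0 i) => [j|] ->; rewrite ?tnthS ?theadE.
rewrite product_measure1E//; last exact: measurable_box.
have I_lty : (lebesgue_measure (`[(- M)%R, M]%classic : set (measurableTypeR R)) < +oo)%E.
  by rewrite lebesgue_measure_itv /=; case: ifP => _; rewrite ltry.
by apply: lte_mul_pinfty => //; rewrite ge0_fin_numE.
Qed.

Lemma leb_bounded_lty d (A : set (euclid R d)) :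
  measurable A -> bounded_subset A -> (leb R d A < +oo)%E.
Proof.
move=> mA [M AM]; apply: le_lt_trans (leb_box_lty d M).
by apply: le_measure; rewrite ?inE//; exact: measurable_box.
Qed.

Lemma scaleK d (r : R) : r != 0 -> cancel (@scale R d r) (scale r^-1).
Proof.
by move=> r0 x; apply: eq_from_tnth => i; rewrite !tnth_mktuple mulKf.
Qed.

Lemma dilateE d (r : R) (A : set (euclid R d)) : r != 0 ->
  dilate r A = scale r^-1 @^-1` A.
Proof.
move=> r0; apply/seteqP; split=> [_ [x Ax <-]|x Ax] /=; first by rewrite scaleK.
have rV0 : r^-1 != 0 by rewrite invr_eq0.
by exists (scale r^-1 x) => //; have := scaleK rV0 x; rewrite invrK.
Qed.

Lemma measurable_dilate d (r : R) (A : set (euclid R d)) : r != 0 ->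
  measurable A -> measurable (dilate r A).
Proof.
move=> r0 mA; rewrite dilateE// -[X in measurable X]setTI.
exact: measurable_scale.
Qed.

Lemma bounded_dilate d (r : R) (A : set (euclid R d)) :
  bounded_subset A -> bounded_subset (dilate r A).
Proof.
move=> [M AM]; exists (`|r| * M) => _ [x Ax <-] i.
by rewrite tnth_mktuple normrM ler_wpM2l// AM.
Qed.

(** The indicator of the dilate at x is that of A at x/r, so this is the change of variables of
    ratio r^-1. *)
Lemma leb_dilate d (r : R) (A : set (euclid R d)) : 0 < r -> measurable A ->
  leb R d (dilate r A) = ((r ^+ d)%:E * leb R d A)%E.
Proof.
move=> r0 mA; have mdA : measurable (dilate r A) by apply: measurable_dilate; rewrite ?gt_eqF.
have rV0 : 0 < r^-1 by rewrite invr_gt0.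
have mI : measurable_fun setT (fun x : euclid R d => (\1_A x : R)%:E) by apply/measurable_EFinP; exact: measurable_indic.
rewrite -[in RHS](setIT A) -integral_indic// -[in LHS](setIT (dilate r A)) -integral_indic//.
rewrite -[X in (X%:E * _)%E]invrK -exprVn -(ge0_integral_leb_scale rV0 mI)//.
by apply: eq_integral => x _; rewrite dilateE ?gt_eqF.
Qed.
End leb_sets.

(** * The Hilbert space of square integrable functions *)

Section squared_modulus.
Context {R : realType}.
Implicit Types z w : R[i].

(** The squared modulus as a real polynomial, without the square root of [Normc.normc]: identities
    and bounds become real algebra. *)
Definition sqn z : R := complex.Re z ^+ 2 + complex.Im z ^+ 2.

Lemma sqn_ge0 z : 0 <= sqn z.
Proof. by rewrite addr_ge0// sqr_ge0. Qed.

Lemma normc_sqr z : Normc.normc z ^+ 2 = sqn z.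
Proof. by case: z => a b; rewrite /= sqr_sqrtr// addr_ge0// sqr_ge0. Qed.

Lemma mul_conjc z : z * z^*%C = (sqn z)%:C%C.
Proof. by case: z => a b; apply/eqP; rewrite eq_complex /sqn /=; apply/andP; split; apply/eqP; ring. Qed.

Lemma sqnM z w : sqn (z * w) = sqn z * sqn w.
Proof. by case: z w => a b [c e]; rewrite /sqn /=; ring. Qed.

Lemma sqn_conj z : sqn z^*%C = sqn z.
Proof. by case: z => a b; rewrite /sqn /=; ring. Qed.

Lemma sqn0 : sqn 0 = 0.
Proof. by rewrite /sqn /= expr0n /= addr0. Qed.

Lemma sqn_real (a : R) : sqn a%:C%C = a ^+ 2.
Proof. by rewrite /sqn /= expr0n /= addr0. Qed.

Lemma sqnD_le z w : sqn (z + w) <= 2 * (sqn z + sqn w).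
Proof.
case: z w => a b [c e]; rewrite /sqn /=.
by have := sqr_ge0 (a - c); have := sqr_ge0 (b - e); nra.
Qed.

Lemma sqn_eq0 z : sqn z = 0 -> z = 0.
Proof.
case: z => a b; rewrite /sqn /= => /eqP.
rewrite paddr_eq0 ?sqr_ge0// !sqrf_eq0 => /andP[/eqP -> /eqP ->].
by apply/eqP; rewrite eq_complex /= !eqxx.
Qed.

(** A crude bound, enough to make the product of two square integrable functions integrable without
    Cauchy-Schwarz. *)
Lemma Re_mul_le z w : `|complex.Re (z * w)| <= sqn z + sqn w.
Proof.
case: z w => a b [c e]; rewrite /sqn /= ler_norml.
have := sqr_ge0 (a - c); have := sqr_ge0 (b - e); have := sqr_ge0 (a + c).
have := sqr_ge0 (b + e); have := sqr_ge0 (a - e); have := sqr_ge0 (a + e).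
have := sqr_ge0 (b - c); have := sqr_ge0 (b + c).
by move=> *; apply/andP; split; nra.
Qed.

Lemma Im_mul_le z w : `|complex.Im (z * w)| <= sqn z + sqn w.
Proof.
case: z w => a b [c e]; rewrite /sqn /= ler_norml.
have := sqr_ge0 (a - c); have := sqr_ge0 (b - e); have := sqr_ge0 (a + c).
have := sqr_ge0 (b + e); have := sqr_ge0 (a - e); have := sqr_ge0 (a + e).
have := sqr_ge0 (b - c); have := sqr_ge0 (b + c).
by move=> *; apply/andP; split; nra.
Qed.

Lemma Re_sqr_le z : complex.Re z ^+ 2 <= sqn z.
Proof. by rewrite lerDl sqr_ge0. Qed.

Lemma Im_sqr_le z : complex.Im z ^+ 2 <= sqn z.
Proof. by rewrite lerDr sqr_ge0. Qed.

Lemma ReM z w : complex.Re (z * w) = complex.Re z * complex.Re w - complex.Im z * complex.Im w.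
Proof. by case: z w => a b [c e]. Qed.

Lemma ImM z w : complex.Im (z * w) = complex.Re z * complex.Im w + complex.Im z * complex.Re w.
Proof. by case: z w => a b [c e]. Qed.

Lemma ReD z w : complex.Re (z + w) = complex.Re z + complex.Re w.
Proof. by case: z w => a b [c e]. Qed.

Lemma ImD z w : complex.Im (z + w) = complex.Im z + complex.Im w.
Proof. by case: z w => a b [c e]. Qed.

Lemma Re_conj z : complex.Re z^*%C = complex.Re z.
Proof. by case: z. Qed.

Lemma Im_conj z : complex.Im z^*%C = - complex.Im z.
Proof. by case: z. Qed.

Lemma conjcM z w : (z * w)^*%C = z^*%C * w^*%C.
Proof. exact: (rmorphM (@conjc R)). Qed.

Lemma complex_ext z w : complex.Re z = complex.Re w -> complex.Im z = complex.Im w -> z = w.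
Proof. by case: z w => a b [c e] /= -> ->. Qed.

End squared_modulus.

Section cmeasurable_theory.
Context {R : realType} {disp : measure_display} {T : measurableType disp}.
Implicit Types f g : T -> R[i].

Lemma cmeasurable_cst (z : R[i]) : cmeasurable (fun _ : T => z).
Proof. by split; exact: measurable_cst. Qed.

Lemma cmeasurableD f g : cmeasurable f -> cmeasurable g -> cmeasurable (fun x => f x + g x).
Proof.
move=> [f1 f2] [g1 g2]; split.
  by under eq_fun do rewrite ReD; exact: measurable_funD.
by under eq_fun do rewrite ImD; exact: measurable_funD.
Qed.

Lemma cmeasurableM f g : cmeasurable f -> cmeasurable g -> cmeasurable (fun x => f x * g x).
Proof.
move=> [f1 f2] [g1 g2]; split.
  by under eq_fun do rewrite ReM; apply: measurable_funB; exact: measurable_funM.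
by under eq_fun do rewrite ImM; apply: measurable_funD; exact: measurable_funM.
Qed.

Lemma cmeasurable_conj f : cmeasurable f -> cmeasurable (fun x => (f x)^*%C).
Proof.
move=> [f1 f2]; split.
  by under eq_fun do rewrite Re_conj.
by under eq_fun do rewrite Im_conj; exact: measurableT_comp.
Qed.

Lemma cmeasurable_real (f : T -> R) : measurable_fun setT f -> cmeasurable (fun x => (f x)%:C%C).
Proof. by move=> mf; split => //=; exact: measurable_cst. Qed.

Lemma measurable_sqn f : cmeasurable f -> measurable_fun setT (fun x => sqn (f x)).
Proof. by move=> [f1 f2]; apply: measurable_funD; exact: measurable_funX. Qed.

Lemma cmeasurable_comp (disp' : measure_display) (T' : measurableType disp') (h : T' -> T) f :
  measurable_fun setT h -> cmeasurable f -> cmeasurable (fun x => f (h x)).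
Proof. by move=> mh [f1 f2]; split; [exact: measurableT_comp f1 mh|exact: measurableT_comp f2 mh]. Qed.

End cmeasurable_theory.

(** * Squared norms and the inner product *)

Section L2_theory.
Context {R : realType} {d : nat}.
Local Notation T := (euclid R d).
Local Notation mu := (leb R d).
Implicit Types f g h u v : T -> R[i].

(** The squared norm stays an extended real and free of roots, so that Tonelli and exchanges of sums
    and integrals apply to it directly; [L2E] reads membership in [L2] off its finiteness. *)
Definition nsq f : \bar R := (\int[mu]_x (sqn (f x))%:E)%E.

Lemma nsq_ge0 f : (0 <= nsq f)%E.
Proof. by apply: integral_ge0 => x _; rewrite lee_fin sqn_ge0. Qed.

Lemma L2norm_sqr f : (L2norm f `^ 2 = nsq f)%E.
Proof.
rewrite /L2norm poweR_Lnorm// /nsq; apply: eq_integral => x _.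
by rewrite abse_EFin poweR_EFin powR_mulrn// real_normK ?num_real// normc_sqr.
Qed.

Lemma L2norm_nsq f : (L2norm f = nsq f `^ 2^-1)%E.
Proof. by rewrite -L2norm_sqr -poweRrM mulfV// poweRe1// Lnorm_ge0. Qed.

Lemma L2E f : L2 f <-> cmeasurable f /\ (nsq f < +oo)%E.
Proof.
split=> -[mf foo]; split => //; first by rewrite -L2norm_sqr poweR_lty.
by rewrite L2norm_nsq poweR_lty.
Qed.

Lemma L2_cmeasurable f : L2 f -> cmeasurable f.
Proof. by case. Qed.

Lemma L2_fin f : L2 f -> nsq f = (fine (nsq f))%:E.
Proof. by move=> /L2E[_ foo]; rewrite fineK// ge0_fin_numE// nsq_ge0. Qed.

Lemma measurable_sqnE f : cmeasurable f -> measurable_fun setT (fun x => (sqn (f x))%:E).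
Proof. by move=> /measurable_sqn mf; exact/measurable_EFinP. Qed.

Lemma integrable_sqn f : L2 f -> mu.-integrable setT (fun x => (sqn (f x))%:E).
Proof.
move=> /L2E[mf foo]; apply/integrableP; split; first exact: measurable_sqnE.
by under eq_integral do rewrite abse_EFin ger0_norm ?sqn_ge0//.
Qed.

Lemma nsqZ (a : R[i]) f : cmeasurable f -> nsq (fun x => a * f x) = ((sqn a)%:E * nsq f)%E.
Proof.
move=> mf; rewrite /nsq -ge0_integralZl_EFin ?sqn_ge0//.
- by apply: eq_integral => x _; rewrite sqnM EFinM.
- by move=> x _; rewrite lee_fin sqn_ge0.
- exact: measurable_sqnE.
Qed.

Lemma L2Z (a : R[i]) f : L2 f -> L2 (fun x => a * f x).
Proof.
move=> /L2E[mf foo]; apply/L2E; split.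
  by apply: cmeasurableM => //; exact: cmeasurable_cst.
by rewrite nsqZ// lte_mul_pinfty// lee_fin sqn_ge0.
Qed.

Lemma L2D f g : L2 f -> L2 g -> L2 (fun x => f x + g x).
Proof.
move=> Lf Lg; have [mf foo] := (L2E f).1 Lf; have [mg goo] := (L2E g).1 Lg.
apply/L2E; split; first exact: cmeasurableD.
apply: (@le_lt_trans _ _ (\int[mu]_x (2 * (sqn (f x) + sqn (g x)))%R%:E)%E).
  apply: ge0_le_integral => //.
  - by move=> x _; rewrite lee_fin sqn_ge0.
  - by apply: measurable_sqnE; exact: cmeasurableD.
  - apply/measurable_EFinP; apply: measurable_funM => //.
    by apply: measurable_funD; exact: measurable_sqn.
  - by move=> x _; rewrite lee_fin sqnD_le.
under eq_integral do rewrite EFinM [X in (_ * X)%E]EFinD.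
rewrite ge0_integralZl_EFin//; last 2 first.
- by move=> x _; rewrite -EFinD lee_fin addr_ge0// sqn_ge0.
- by apply: emeasurable_funD; exact: measurable_sqnE.
rewrite ge0_integralD//; last 4 first.
- by move=> x _; rewrite lee_fin sqn_ge0.
- exact: measurable_sqnE.
- by move=> x _; rewrite lee_fin sqn_ge0.
- exact: measurable_sqnE.
by rewrite lte_mul_pinfty// lte_add_pinfty.
Qed.

Lemma L2_0 : L2 (fun _ : T => 0 : R[i]).
Proof.
apply/L2E; split; first exact: cmeasurable_cst.
by rewrite /nsq; under eq_integral do rewrite sqn0; rewrite integral0 ltry.
Qed.

Lemma L2_sum (r : seq nat) (f : nat -> T -> R[i]) :
  (forall k, L2 (f k)) -> L2 (fun x => \sum_(k <- r) f k x).
Proof.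
move=> Lf; elim: r => [|k r IH].
  by under [X in L2 X]eq_fun do rewrite big_nil; exact: L2_0.
by under [X in L2 X]eq_fun do rewrite big_cons; exact: L2D.
Qed.

Lemma L2B f g : L2 f -> L2 g -> L2 (fun x => f x - g x).
Proof.
move=> Lf Lg; under [X in L2 X]eq_fun => x do rewrite -[- g x]mulN1r.
by apply: L2D => //; exact: L2Z.
Qed.

Lemma nsq_le f g : cmeasurable f -> cmeasurable g ->
  (forall x, sqn (f x) <= sqn (g x)) -> (nsq f <= nsq g)%E.
Proof.
move=> mf mg fg; apply: ge0_le_integral => //.
- by move=> x _; rewrite lee_fin sqn_ge0.
- exact: measurable_sqnE.
- exact: measurable_sqnE.
- by move=> x _; rewrite lee_fin fg.
Qed.

Lemma nsq_ae f g : cmeasurable f -> cmeasurable g -> f = g %[ae mu] -> nsq f = nsq g.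
Proof.
move=> mf mg fg; apply: ge0_ae_eq_integral => //.
- exact: measurable_sqnE.
- exact: measurable_sqnE.
- by move=> x _; rewrite lee_fin sqn_ge0.
- by move=> x _; rewrite lee_fin sqn_ge0.
- by apply: filterS fg => x /= /(_ I) -> _.
Qed.

Lemma nsq0_ae f : cmeasurable f -> nsq f = 0%E -> f = cst 0 %[ae mu].
Proof.
move=> mf f0.
have := (ae_eq_integral_abs mu measurableT (measurable_sqnE mf)).1.
under eq_integral do rewrite abse_EFin ger0_norm ?sqn_ge0//.
move=> /(_ f0); apply: filterS => x /= /(_ I) [] /sqn_eq0 -> //.
Qed.

Definition cintegrable u := mu.-integrable setT (fun x => (complex.Re (u x))%:E) /\
  mu.-integrable setT (fun x => (complex.Im (u x))%:E).

Lemma cintegrable_mul f g : L2 f -> L2 g -> cintegrable (fun x => f x * (g x)^*%C).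
Proof.
move=> Lf Lg; have mfg : cmeasurable (fun x => f x * (g x)^*%C).
  apply: cmeasurableM; [exact: L2_cmeasurable|].
  by apply: cmeasurable_conj; exact: L2_cmeasurable.
have ifg : mu.-integrable setT (fun x => (sqn (f x) + sqn (g x))%:E).
  exact: (integrableD measurableT (integrable_sqn Lf) (integrable_sqn Lg)).
have E x : `|sqn (f x) + sqn (g x)| = sqn (f x) + sqn (g x).
  by rewrite ger0_norm// addr_ge0// sqn_ge0.
split; apply: (le_integrable _ _ _ ifg) => //.
- by apply/measurable_EFinP; case: mfg.
- by move=> x _; rewrite !abse_EFin lee_fin E -(sqn_conj (g x)) Re_mul_le.
- by apply/measurable_EFinP; case: mfg.
- by move=> x _; rewrite !abse_EFin lee_fin E -(sqn_conj (g x)) Im_mul_le.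
Qed.

Lemma cintegralD u v : cintegrable u -> cintegrable v ->
  cintegral (fun x => u x + v x) = cintegral u + cintegral v.
Proof.
move=> [u1 u2] [v1 v2]; rewrite /cintegral; apply: complex_ext => /=.
  by under eq_Rintegral do rewrite ReD; rewrite RintegralD.
by under eq_Rintegral do rewrite ImD; rewrite RintegralD.
Qed.

Lemma cintegralZ (a : R[i]) u : cintegrable u ->
  cintegral (fun x => a * u x) = a * cintegral u.
Proof.
move=> [u1 u2]; rewrite /cintegral; apply: complex_ext => /=; rewrite ?ReM ?ImM /=.
  under eq_Rintegral do rewrite ReM; rewrite RintegralB// ?RintegralZl//.
  - exact: integrableZl u1.
  - exact: integrableZl u2.
under eq_Rintegral do rewrite ImM; rewrite RintegralD// ?RintegralZl//.
- exact: integrableZl u2.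
- exact: integrableZl u1.
Qed.

Lemma cintegral_ae u v : cmeasurable u -> cmeasurable v -> u = v %[ae mu] ->
  cintegral u = cintegral v.
Proof.
move=> [u1 u2] [v1 v2] uv; rewrite /cintegral; apply: complex_ext => /=; congr fine.
  apply: ae_eq_integral => //; [exact/measurable_EFinP|exact/measurable_EFinP|].
  by apply: filterS uv => x /= /(_ I) ->.
apply: ae_eq_integral => //; [exact/measurable_EFinP|exact/measurable_EFinP|].
by apply: filterS uv => x /= /(_ I) ->.
Qed.

Lemma cmeasurable_mulconj f g : cmeasurable f -> cmeasurable g ->
  cmeasurable (fun x => f x * (g x)^*%C).
Proof. by move=> mf mg; apply: cmeasurableM => //; exact: cmeasurable_conj. Qed.

Lemma inner_ae f f' g g' : L2 f -> L2 f' -> L2 g -> L2 g' ->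
  f = f' %[ae mu] -> g = g' %[ae mu] -> inner f g = inner f' g'.
Proof.
move=> /L2_cmeasurable mf /L2_cmeasurable mf' /L2_cmeasurable mg /L2_cmeasurable mg' ff' gg'.
apply: cintegral_ae; [exact: cmeasurable_mulconj|exact: cmeasurable_mulconj|].
by apply: filterS2 ff' gg' => x /= h1 h2 _; rewrite h1// h2.
Qed.

Lemma innerDl f g h : L2 f -> L2 g -> L2 h ->
  inner (fun x => f x + g x) h = inner f h + inner g h.
Proof.
move=> Lf Lg Lh; rewrite /inner -cintegralD; try exact: cintegrable_mul.
by congr cintegral; apply/funext => x; rewrite mulrDl.
Qed.

Lemma innerZl (a : R[i]) f g : L2 f -> L2 g -> inner (fun x => a * f x) g = a * inner f g.
Proof.
move=> Lf Lg; rewrite /inner -cintegralZ; last exact: cintegrable_mul.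
by congr cintegral; apply/funext => x; rewrite mulrA.
Qed.

Lemma inner_conj f g : L2 f -> L2 g -> inner g f = (inner f g)^*%C.
Proof.
move=> Lf Lg; have [i1 i2] := cintegrable_mul Lf Lg.
rewrite /inner /cintegral; apply: complex_ext => /=.
  by apply: eq_Rintegral => x _; rewrite !ReM !Re_conj !Im_conj; ring.
rewrite -mulN1r -RintegralZl//; apply: eq_Rintegral => x _.
by rewrite !ImM !Re_conj !Im_conj; ring.
Qed.

Lemma innerZr (a : R[i]) f g : L2 f -> L2 g ->
  inner g (fun x => a * f x) = a^*%C * inner g f.
Proof.
move=> Lf Lg; rewrite inner_conj ?innerZl//; last exact: L2Z.
by rewrite conjcM -!inner_conj.
Qed.

Lemma inner_diag f : L2 f -> inner f f = (fine (nsq f))%:C%C.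
Proof.
move=> Lf; rewrite /inner /cintegral; apply: complex_ext => /=.
  by congr fine; apply: eq_integral => x _; rewrite mul_conjc.
by under eq_Rintegral do rewrite mul_conjc /=; rewrite Rintegral_cst// mul0r.
Qed.

Lemma inner0l g : L2 g -> inner (fun _ => 0) g = 0.
Proof.
move=> Lg; have E : (fun _ : T => 0 : R[i]) = (fun x => 0 * g x).
  by apply/funext => x; rewrite mul0r.
by rewrite {1}E innerZl// mul0r.
Qed.

Lemma innerBl f g h : L2 f -> L2 g -> L2 h ->
  inner (fun x => f x - g x) h = inner f h - inner g h.
Proof.
move=> Lf Lg Lh; under [X in inner X _]eq_fun => x do rewrite -[- g x]mulN1r.
by rewrite innerDl ?innerZl ?mulN1r//; exact: L2Z.
Qed.

Lemma inner_suml (r : seq nat) (f : nat -> T -> R[i]) g : (forall k, L2 (f k)) -> L2 g ->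
  inner (fun x => \sum_(k <- r) f k x) g = \sum_(k <- r) inner (f k) g.
Proof.
move=> Lf Lg; elim: r => [|k r IH].
  by under [X in inner X]eq_fun do rewrite big_nil; rewrite inner0l// big_nil.
under [X in inner X]eq_fun do rewrite big_cons.
by rewrite innerDl// ?IH ?big_cons//; exact: L2_sum.
Qed.

End L2_theory.

(** * Bessel's inequality for orthogonal vectors of norm at most one *)

Section Bessel.
Context {R : realType} {d : nat}.
Local Notation T := (euclid R d).
Implicit Types f g h : T -> R[i].

(** The real squared norm, used on [L2] functions; an infinite [nsq f] would give the default value
    0. *)
Definition nn f : R := fine (nsq f).

Lemma nn_ge0 f : 0 <= nn f.
Proof. by rewrite fine_ge0// nsq_ge0. Qed.

Lemma nn_Re f : L2 f -> nn f = complex.Re (inner f f).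
Proof. by move=> Lf; rewrite inner_diag. Qed.

Lemma nnB f g : L2 f -> L2 g ->
  nn (fun x => f x - g x) = nn f - 2 * complex.Re (inner g f) + nn g.
Proof.
move=> Lf Lg; have Lfg := L2B Lf Lg.
rewrite !nn_Re// innerBl// [inner f (fun _ => _)]inner_conj//.
rewrite [inner g (fun _ => _)]inner_conj// !innerBl// (inner_conj Lg Lf).
rewrite -[complex.Re (inner g g)]Re_conj -(inner_conj Lg Lg).
rewrite -[complex.Re (inner f f)]Re_conj -(inner_conj Lf Lf).
case: (inner f f) (inner g g) (inner g f) => a b [a' b'] [a'' b''] /=.
ring.
Qed.

Variables (e : nat -> T -> R[i]) (b : nat -> R).
Hypothesis Le : forall k, L2 (e k).

Definition comb (c : nat -> R[i]) (r : seq nat) : T -> R[i] :=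
  fun x => \sum_(k <- r) c k * e k x.

Lemma L2_comb c r : L2 (comb c r).
Proof. by apply: (@L2_sum _ _ r (fun k x => c k * e k x)) => k; exact: L2Z. Qed.

Lemma comb_cat c m n p x : (m <= n)%N -> (n <= p)%N ->
  comb c (index_iota m p) x = comb c (index_iota m n) x + comb c (index_iota n p) x.
Proof. by move=> mn np; rewrite /comb (big_cat_nat mn np). Qed.

Lemma inner_comb c r f : L2 f -> inner (comb c r) f = \sum_(k <- r) c k * inner (e k) f.
Proof.
move=> Lf; rewrite (@inner_suml _ _ r (fun k x => c k * e k x))//.
  by apply: eq_bigr => k _; rewrite innerZl.
by move=> k; exact: L2Z.
Qed.

(** The numbers [b k] are the squared norms of the orthogonal vectors [e k]. They may differ from 1
    because the family [Psi] contains null vectors wherever an eigenvalue vanishes. *)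
Lemma nn_comb c r : uniq r ->
  {in r &, forall i j, inner (e i) (e j) = if i == j then (b i)%:C%C else 0} ->
  nn (comb c r) = \sum_(k <- r) b k * sqn (c k).
Proof.
move=> ur on; have Lc := L2_comb c r.
have H k : k \in r -> inner (e k) (comb c r) = (c k)^*%C * (b k)%:C%C.
  move=> kr; rewrite inner_conj// inner_comb// (bigD1_seq k)//= on// eqxx.
  rewrite big1_seq ?addr0 ?conjcM ?conjc_real// => j /andP[jk jr].
  by rewrite on// (negbTE jk) mulr0.
rewrite nn_Re// inner_comb// big_seq (eq_bigr (fun k => (b k * sqn (c k))%:C%C)).
  rewrite -big_seq; elim: (r) => [|k s IH]; first by rewrite !big_nil.
  by rewrite !big_cons ReD IH.
by move=> k kr; rewrite H// mulrA mul_conjc mulrC rmorphM.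
Qed.

Lemma nn_residual r f : L2 f -> uniq r ->
  {in r &, forall i j, inner (e i) (e j) = if i == j then (b i)%:C%C else 0} ->
  nn (fun x => f x - comb (fun k => inner f (e k)) r x) =
  nn f - \sum_(k <- r) (2 - b k) * sqn (inner f (e k)).
Proof.
move=> Lf ur on; rewrite nnB//; last exact: L2_comb.
rewrite nn_comb// inner_comb//.
rewrite (eq_bigr (fun k => (sqn (inner f (e k)))%:C%C)); last first.
  by move=> k _; rewrite (inner_conj Lf (Le k)) mul_conjc.
rewrite -rmorph_sum /= mulr_sumr -addrA -sumrN -sumrN -big_split /=; congr (_ + _).
by apply: eq_bigr => k _; ring.
Qed.

(** The squared norm of the residual is nonnegative, and each factor 2 - b k in it is at least 1. *)
Lemma Bessel r f : L2 f -> uniq r ->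
  {in r &, forall i j, inner (e i) (e j) = if i == j then (b i)%:C%C else 0} ->
  {in r, forall k, b k <= 1} ->
  \sum_(k <- r) sqn (inner f (e k)) <= nn f.
Proof.
move=> Lf ur on b1; have := nn_ge0 (fun x => f x - comb (fun k => inner f (e k)) r x).
rewrite nn_residual// subr_ge0; apply: le_trans.
rewrite !big_seq; apply: ler_sum => k kr.
by rewrite ler_peMl ?sqn_ge0//; have := b1 _ kr; lra.
Qed.

End Bessel.

(** * Parseval identity *)

Section fast_cauchy.
Context {R : realType}.

(** The increments are at most sqrt(g) 2^-k, hence summable with total at most 2 sqrt(g). The bound
    follows from v_k^2 <= 2 v_0^2 + 2 (v_k - v_0)^2 and (v_k - v_0)^2 <= 4 g. *)
Lemma fast_cauchy_cvg (v : nat -> R) (g : R) :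
  (forall k, 4 ^+ k * (v k.+1 - v k) ^+ 2 <= g) ->
  cvgn v /\ forall k, v k ^+ 2 <= 2 * v 0%N ^+ 2 + 8 * g.
Proof.
move=> vg; have g0 : 0 <= g.
  by apply: le_trans (vg 0%N); apply: mulr_ge0; [exact: exprn_ge0|exact: sqr_ge0].
have step k : `|v k.+1 - v k| <= Num.sqrt g * 2^-1 ^+ k.
  rewrite -(@ler_pXn2r _ 2) ?nnegrE ?mulr_ge0 ?sqrtr_ge0 ?exprn_ge0//.
  rewrite exprMn sqr_sqrtr// real_normK ?num_real// -exprM mulnC exprM exprVn.
  rewrite (_ : 2 ^+ 2 = 4 :> R); last by rewrite -natrX.
  by rewrite exprVn ler_pdivlMr ?exprn_gt0// mulrC.
have geo : cvgn (series (geometric (Num.sqrt g) (2^-1 : R))).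
  by apply: is_cvg_geometric_series; rewrite ger0_norm ?invr_ge0// invf_lt1 ?ltr1n.
have vE n : v n = v 0%N + series (fun k => v k.+1 - v k) n.
  by rewrite /series /= telescope_sumr// addrC subrK.
have cs : cvgn (series (fun k => v k.+1 - v k)).
  apply: normed_cvg; apply: series_le_cvg geo => k; rewrite /geometric /=.
  - exact: normr_ge0.
  - by rewrite mulr_ge0 ?sqrtr_ge0 ?exprn_ge0.
  - exact: step.
split.
  rewrite (_ : v = (fun n => v 0%N + series (fun k => v k.+1 - v k) n)); last exact/funext.
  exact: is_cvgD (is_cvg_cst _) cs.
move=> k; have H : `|v k - v 0%N| <= 2 * Num.sqrt g.
  rewrite vE addrC addKr /series /=; apply: le_trans (ler_norm_sum _ _ _) _.
  apply: (@le_trans _ _ (\sum_(0 <= i < k) Num.sqrt g * 2^-1 ^+ i)).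
    by apply: ler_sum => i _; exact: step.
  rewrite -mulr_sumr mulrC ler_wpM2r ?sqrtr_ge0//.
  have -> : \sum_(0 <= i < k) (2^-1 : R) ^+ i = 2 - 2 * 2^-1 ^+ k.
    elim: k => [|n IH]; first by rewrite big_nil expr0 mulr1 subrr.
    by rewrite big_nat_recr//= IH exprS; field.
  by rewrite gerBl mulr_ge0// exprn_ge0.
have s2 : (v k - v 0%N) ^+ 2 <= 4 * g.
  rewrite -[X in X ^+ 2 <= _]/(v k - v 0%N) -real_normK ?num_real//.
  rewrite (_ : 4 * g = (2 * Num.sqrt g) ^+ 2); last by rewrite exprMn sqr_sqrtr// -natrX.
  by rewrite ler_pXn2r// nnegrE// mulr_ge0// sqrtr_ge0.
have := sqr_ge0 (v k - 2 * v 0%N); nra.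
Qed.

(** The tails of a convergent series become arbitrarily small. The rate 16^-k leaves a summable 4^-k
    after multiplication by the weights 4^k of [fast_cauchy_cvg]. *)
Lemma fast_blocks (a : nat -> R) (M : R) : (forall k, 0 <= a k) ->
  (forall n, \sum_(0 <= k < n) a k <= M) ->
  exists2 n : nat -> nat, {homo n : i j / (i < j)%N} &
    forall k, \sum_(n k <= i < n k.+1) a i <= 16^-1 ^+ k.
Proof.
move=> a0 aM.
have cS : cvgn (series a).
  apply: nondecreasing_is_cvgn; first by apply: nondecreasing_series => i _ _.
  by exists M => _ [n _ <-]; exact: aM.
have H k : exists N, forall n m, (N <= n)%N -> (n <= m)%N ->
    \sum_(n <= i < m) a i <= 16^-1 ^+ k.
  have e0 : (0 : R) < 16^-1 ^+ k by rewrite exprn_gt0// invr_gt0.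
  have /cvgrPdist_lt/(_ _ e0)[N _ HN] := cS.
  exists N => n m Nn nm.
  have Sle : series a m <= limn (series a).
    by apply: nondecreasing_cvgn_le => //; apply: nondecreasing_series => i _ _.
  have := HN n Nn; have -> : \sum_(n <= i < m) a i = series a m - series a n.
    by rewrite /series /= (@big_cat_nat _ _ _ n 0 m)//= addrAC subrr add0r.
  by move=> /ltr_normlW /ltW; apply: le_trans; rewrite lerD2r.
have [N HN] := choice H.
(* Adding [N k] places [n k] beyond the threshold for 16^-k; the successor makes the sequence
   strictly increasing. *)
pose n := fix n k := match k with 0 => N 0%N | S k' => (n k' + N k).+1 end.
have ninc k : (n k < n k.+1)%N by rewrite /= ltnS leq_addr.
exists n; first exact: (homo_ltn ltn_trans ninc).
move=> k; apply: HN; last exact: ltnW.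
by case: k => [|k] //=; rewrite leqW// leq_addl.
Qed.

End fast_cauchy.

Lemma dominated_cvg_integral {R : realType} {dsp : measure_display} {T : measurableType dsp}
    (mu : {measure set T -> \bar R}) (f_ : nat -> T -> R) (f : T -> R) (H : T -> \bar R) :
  (forall k, measurable_fun setT (f_ k)) -> (forall x, f_ ^~ x @ \oo --> f x) ->
  mu.-integrable setT H -> (forall k x, (`|f_ k x|%:E <= H x)%E) ->
  mu.-integrable setT (EFin \o f) /\
  (\int[mu]_x (f_ k x)%:E)%E @[k --> \oo] --> (\int[mu]_x (f x)%:E)%E.
Proof.
move=> mf_ f_f iH fH; have mf : measurable_fun setT f.
  exact: (measurable_fun_cvg mf_ (fun x _ => f_f x)).
have [i _ c] := @dominated_convergence _ _ _ mu setT measurableT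
  (fun k x => (f_ k x)%:E) (fun x => (f x)%:E) H
  (fun k => (measurable_EFinP _ _).2 (mf_ k)) ((measurable_EFinP _ _).2 mf)
  (aeW _ (fun x _ => cvg_EFin (f := fun k => (f_ k x)%:E) (nearW _ (fun=> isT)) (f_f x))) iH
  (aeW _ (fun x k _ => fH k x)).
by split.
Qed.

(** * Dominated pointwise limits in the space of square integrable functions *)

Section dominated.
Context {R : realType} {d : nat}.
Local Notation T := (euclid R d).
Local Notation mu := (leb R d).
Variables (U : nat -> T -> R[i]) (g : T -> R[i]) (H : T -> \bar R).
Hypothesis mU : forall k, cmeasurable (U k).
Hypothesis Ug : forall x, complex_cvg (U ^~ x) (g x).
Hypothesis iH : mu.-integrable setT H.
Hypothesis UH : forall k x, ((sqn (U k x))%:E <= H x)%E.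

Lemma cmeasurable_lim : cmeasurable g.
Proof.
split.
  apply: (@measurable_fun_cvg _ _ _ setT (fun k x => complex.Re (U k x))).
    by move=> k; case: (mU k).
  by move=> x _; case: (Ug x).
apply: (@measurable_fun_cvg _ _ _ setT (fun k x => complex.Im (U k x))).
  by move=> k; case: (mU k).
by move=> x _; case: (Ug x).
Qed.

Lemma sqn_cvg x : (fun k => sqn (U k x)) @ \oo --> sqn (g x).
Proof. by have [r i] := Ug x; apply: cvgD; rewrite !expr2; apply: cvgM. Qed.

Let UH' k x : (`|sqn (U k x)|%:E <= H x)%E.
Proof. by rewrite ger0_norm ?sqn_ge0. Qed.

Lemma nsq_cvg : nsq (U k) @[k --> \oo] --> nsq g.
Proof. exact: (dominated_cvg_integral (fun k => measurable_sqn (mU k)) sqn_cvg iH UH').2. Qed.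

Lemma L2_lim : L2 g.
Proof.
apply/L2E; split; first exact: cmeasurable_lim.
have [+ _] := dominated_cvg_integral (fun k => measurable_sqn (mU k)) sqn_cvg iH UH'.
case/integrableP => _.
by under eq_integral do rewrite /= ger0_norm ?sqn_ge0//.
Qed.

Lemma inner_cvg (e : T -> R[i]) : L2 e ->
  complex_cvg (fun k => inner (U k) e) (inner g e).
Proof.
move=> Le; have iHe : mu.-integrable setT (H \+ (fun x => (sqn (e x))%:E))%E.
  by apply: integrableD => //; exact: integrable_sqn.
have me := cmeasurable_conj (L2_cmeasurable Le).
have mUe k := cmeasurableM (mU k) me.
have B k x : ((sqn (U k x) + sqn (e x)^*%C)%:E <= H x + (sqn (e x))%:E)%E.
  by rewrite EFinD sqn_conj leeD2r.
split.
- have c x : complex.Re (U k x * (e x)^*%C) @[k --> \oo] --> complex.Re (g x * (e x)^*%C).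
    rewrite ReM; under eq_fun do rewrite ReM.
    have [r i] := Ug x; apply: cvgB; apply: cvgM; try exact: cvg_cst; [exact: r|exact: i].
  have [|i cI] := dominated_cvg_integral (fun k => (mUe k).1) c iHe.
    by move=> k x; apply: le_trans (B k x); rewrite lee_fin Re_mul_le.
  apply: fine_cvg; move: cI; rewrite -[X in _ --> X -> _]fineK//.
  exact: integrable_fin_num i.
- have c x : complex.Im (U k x * (e x)^*%C) @[k --> \oo] --> complex.Im (g x * (e x)^*%C).
    rewrite ImM; under eq_fun do rewrite ImM.
    have [r i] := Ug x; apply: cvgD; apply: cvgM; try exact: cvg_cst; [exact: r|exact: i].
  have [|i cI] := dominated_cvg_integral (fun k => (mUe k).2) c iHe.
    by move=> k x; apply: le_trans (B k x); rewrite lee_fin Im_mul_le.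
  apply: fine_cvg; move: cI; rewrite -[X in _ --> X -> _]fineK//.
  exact: integrable_fin_num i.
Qed.

End dominated.

Section Parseval.
Context {R : realType} {d : nat}.
Local Notation T := (euclid R d).
Local Notation mu := (leb R d).
Variables (e : nat -> T -> R[i]) (f : T -> R[i]).
Hypotheses (eb : orthonormal_basis e) (Lf : L2 f).

Let Le k : L2 (e k). Proof. by case: eb => -[]. Qed.

Let on i j : inner (e i) (e j) = if i == j then (1 : R)%:C%C else 0.
Proof. by case: eb => -[_ ->] _; case: eqP. Qed.

Let c k := inner f (e k).
Let a k := sqn (c k).

Let a_le n : \sum_(0 <= k < n) a k <= nn f.
Proof. by apply: (Bessel Le Lf) => [|i j _ _|k _]; [exact: iota_uniq|exact: on|exact: lexx]. Qed.

(* Riesz-Fischer for the partial Fourier sums: a subsequence converges almost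
   everywhere and dominatedly, and its limit has the same coefficients as [f]. *)
Lemma Parseval : (\sum_(0 <= k <oo) (sqn (inner f (e k)))%:E)%E = nsq f.
Proof.
have [n ninc an] := fast_blocks (fun k => sqn_ge0 (c k)) a_le.
have nk k : (k <= n k)%N by elim: k => // k /leq_ltn_trans; apply; exact: ninc.
pose u k := comb e c (index_iota 0 (n k)).
pose D_ k := comb e c (index_iota (n k) (n k.+1)).
have uS k x : u k.+1 x - u k x = D_ k x.
  by rewrite /u (comb_cat e c x (leq0n (n k)) (ltnW (ninc _ _ (ltnSn k)))) addrC addKr.
have LD k : L2 (D_ k) by exact: L2_comb.
have Lu k : L2 (u k) by exact: L2_comb.
have nD k : (nsq (D_ k) <= (16^-1 ^+ k)%:E)%E.
  rewrite L2_fin// lee_fin -/(nn _) (nn_comb (b := fun=> 1) Le)//; last exact: iota_uniq.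
  by under eq_bigr do rewrite mul1r; exact: an.
have nu k : nsq (u k) = (\sum_(0 <= i < n k) a i)%:E.
  rewrite L2_fin// -/(nn _) (nn_comb (b := fun=> 1) Le)//; last exact: iota_uniq.
  by under eq_bigr do rewrite mul1r.
(* Weighted sum of the squared block increments. Its integral is at most the sum of 4^k 16^-k <=
   2^-k, so it is finite almost everywhere, and where it is finite it controls the increments as
   [fast_cauchy_cvg] requires. *)
pose G x := (\sum_(0 <= k <oo) (4 ^+ k * sqn (D_ k x))%:E)%E.
have G0 k x : (0 <= (4 ^+ k * sqn (D_ k x))%:E)%E.
  by rewrite lee_fin mulr_ge0 ?exprn_ge0// sqn_ge0.
have mG_ k : measurable_fun setT (fun x => (4 ^+ k * sqn (D_ k x))%:E).
  apply/measurable_EFinP; apply: measurable_funM => //.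
  exact/measurable_sqn/L2_cmeasurable.
have mG : measurable_fun setT G by apply: ge0_emeasurable_sum => // k x _ _.
have Gge0 x : (0 <= G x)%E by exact: nneseries_ge0.
have iG : mu.-integrable setT G.
  apply/integrableP; split => //; under eq_integral do rewrite gee0_abs//.
  rewrite /G integral_nneseries//.
  apply: (@le_lt_trans _ _ 2%:E); last by rewrite ltry.
  apply: lime_le; first by apply: is_cvg_nneseries => k _ _; exact: integral_ge0.
  apply: nearW => m.
  apply: (@le_trans _ _ (\sum_(0 <= k < m) (2^-1 ^+ k : R)%:E)%E).
    apply: lee_sum => k _; under eq_integral do rewrite EFinM.
    rewrite ge0_integralZl_EFin ?exprn_ge0//; last 2 first.
    - by move=> x _; rewrite lee_fin sqn_ge0.
    - by apply: measurable_sqnE; exact: L2_cmeasurable.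
    apply: (@le_trans _ _ ((4 ^+ k : R)%:E * (16^-1 ^+ k)%:E)%E).
      by rewrite lee_wpmul2l ?lee_fin ?exprn_ge0//; exact: nD.
    rewrite -EFinM lee_fin -exprMn; apply: lerXn2r; rewrite ?nnegrE//; lra.
  rewrite sumEFin lee_fin.
  have -> : \sum_(0 <= i < m) (2^-1 : R) ^+ i = 2 - 2 * 2^-1 ^+ m.
    elim: m => [|m IH]; first by rewrite big_nil expr0 mulr1 subrr.
    by rewrite big_nat_recr//= IH exprS; field.
  by rewrite gerBl mulr_ge0// exprn_ge0.
pose D := [set x | (G x < +oo)%E].
have mD : measurable D.
  rewrite (_ : D = setT `&` [set x | (G x < +oo)%E]); last by rewrite setTI.
  by apply: emeasurable_fun_infty_o.
have aeD : {ae mu, forall x, D x}.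
  apply: filterS (integrable_ae measurableT iG) => x /= /(_ I).
  by rewrite ge0_fin_numE.
have uD x : D x -> complex_cvg (u ^~ x) (Complex (limn (fun k => complex.Re (u k x)))
      (limn (fun k => complex.Im (u k x)))) /\
    forall k, sqn (u k x) <= 2 * sqn (u 0%N x) + 16 * fine (G x).
  move=> Dx; have Gx : G x = (fine (G x))%:E by rewrite fineK// ge0_fin_numE.
  have DG k : 4 ^+ k * sqn (D_ k x) <= fine (G x).
    rewrite -lee_fin -Gx /G; apply: le_trans (nneseries_lim_ge k.+1 _); last by move=> ? _ _; exact: G0.
    by rewrite big_nat_recr//= leeDr// sume_ge0.
  have [|cr br] := @fast_cauchy_cvg R (fun k => complex.Re (u k x)) (fine (G x)).
    move=> k; apply: le_trans (DG k); rewrite ler_wpM2l ?exprn_ge0// -uS.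
    by apply: le_trans (Re_sqr_le _); case: (u k.+1 x) (u k x) => ? ? [].
  have [|ci bi] := @fast_cauchy_cvg R (fun k => complex.Im (u k x)) (fine (G x)).
    move=> k; apply: le_trans (DG k); rewrite ler_wpM2l ?exprn_ge0// -uS.
    by apply: le_trans (Im_sqr_le _); case: (u k.+1 x) (u k x) => ? ? [].
  by split=> // k; have := br k; have := bi k; rewrite /sqn; lra.
(* Cutting off outside [D], whose complement is null, makes convergence and domination hold at every
   point. *)
pose U k x : R[i] := (\1_D x)%:C%C * u k x.
pose g x := Complex (limn (fun k => complex.Re (U k x))) (limn (fun k => complex.Im (U k x))).
have UE k x : U k x = if x \in D then u k x else 0.
  by rewrite /U indicE; case: (x \in D); rewrite ?mul1r ?mul0r.
have mU k : cmeasurable (U k).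
  apply: cmeasurableM; last exact: L2_cmeasurable.
  by apply: cmeasurable_real; exact: measurable_indic.
have Ug x : complex_cvg (U ^~ x) (g x).
  rewrite /g; under eq_fun do rewrite UE.
  under [X in (Complex (limn X) _)]eq_fun do rewrite UE.
  under [X in (Complex _ (limn X))]eq_fun do rewrite UE.
  have [/set_mem Dx|nDx] := boolP (x \in D); first exact: (uD x Dx).1.
  by split; rewrite /= lim_cst//; exact: cvg_cst.
(* The constant 16 is 8 for the real part plus 8 for the imaginary part. *)
pose H x := ((2 * sqn (u 0%N x))%:E + 16%:E * G x)%E.
have UH k x : ((sqn (U k x))%:E <= H x)%E.
  rewrite UE; have [/set_mem Dx|nDx] := boolP (x \in D).
    have Gx : G x = (fine (G x))%:E by rewrite fineK// ge0_fin_numE.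
    by rewrite /H Gx -EFinM -EFinD lee_fin; exact: (uD x Dx).2.
  rewrite sqn0 adde_ge0// ?mule_ge0 ?lee_fin// ?mulr_ge0 ?sqn_ge0//.
have iH : mu.-integrable setT H.
  apply: integrableD => //; last exact: integrableZl iG.
  by under eq_fun do rewrite EFinM; apply: integrableZl => //; exact: integrable_sqn.
have Lg : L2 g := L2_lim mU Ug iH UH.
have Uu k : U k = u k %[ae mu].
  by apply: filterS aeD => x Dx _; rewrite UE mem_set.
have LU k : L2 (U k).
  apply/L2E; split => //; rewrite (nsq_ae (mU k) (L2_cmeasurable (Lu k)) (Uu k)).
  by case/L2E: (Lu k).
have gc m : inner g (e m) = c m.
  have [r i] := inner_cvg mU Ug iH UH (Le m).
  have Ec : \forall k \near \oo, inner (U k) (e m) = c m.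
    exists m.+1 => // k /= mk; rewrite (inner_ae (LU k) (Lu k) (Le m) (Le m) (Uu k) (ae_eq_refl _ _ _)).
    rewrite inner_comb// (bigD1_seq m)/= ?iota_uniq//; last first.
      by rewrite mem_index_iota/= (leq_trans mk).
    rewrite on eqxx mulr1 big1 ?addr0// => j jm; rewrite on (negbTE jm) mulr0//.
  apply: complex_ext.
    apply: (cvg_unique _ r) => //; apply: cvg_near_cst.
    by apply: filterS Ec => k ->.
  apply: (cvg_unique _ i) => //; apply: cvg_near_cst.
  by apply: filterS Ec => k ->.
(* The difference f - g has all its coefficients equal to 0, and the basis is complete. *)
have fg : f = g %[ae mu].
  have fg0 : (fun x => f x - g x) = cst 0 %[ae mu].
    apply: eb.2; first exact: L2B.
    by move=> m; rewrite innerBl// gc subrr.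
  by apply: filterS fg0 => x /= /(_ I) /eqP; rewrite subr_eq0 => /eqP.
rewrite (nsq_ae (L2_cmeasurable Lf) (L2_cmeasurable Lg) fg).
have c1 := nsq_cvg mU Ug iH UH.
have c2 : nsq (U k) @[k --> \oo] --> (\sum_(0 <= k <oo) (a k)%:E)%E.
  have -> : (fun k => nsq (U k)) = (fun m => (\sum_(0 <= i < m) (a i)%:E)%E) \o n.
    apply/funext => k /=; rewrite sumEFin -nu.
    exact: nsq_ae (L2_cmeasurable (Lu k)) (Uu k).
  apply: cvg_comp; last by apply: is_cvg_nneseries => k _ _; rewrite lee_fin sqn_ge0.
  apply/cvgnyPge => m; exists m => // k /= mk; exact: leq_trans (nk k).
exact: (cvg_unique _ c2 c1).
Qed.

End Parseval.

(** * Concentration operators of a projection kernel *)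

Section cutoff.
Context {R : realType} {d : nat}.
Local Notation T := (euclid R d).
Local Notation mu := (leb R d).
Implicit Types (A : set T) (f g : T -> R[i]).

Lemma cmeasurable_cutoff A f : measurable A -> cmeasurable f -> cmeasurable (cutoff A f).
Proof.
move=> mA mf; apply: cmeasurableM => //.
by apply: cmeasurable_real; exact: measurable_indic.
Qed.

Lemma sqn_cutoff A f x : sqn (cutoff A f x) = \1_A x * sqn (f x).
Proof. by rewrite /cutoff sqnM sqn_real indicE; case: (_ \in _); rewrite ?expr1n// expr0n. Qed.

Lemma L2_cutoff A f : measurable A -> L2 f -> L2 (cutoff A f).
Proof.
move=> mA /L2E[mf foo]; apply/L2E; split; first exact: cmeasurable_cutoff.
apply: le_lt_trans foo; apply: nsq_le => //; first exact: cmeasurable_cutoff.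
by move=> x; rewrite sqn_cutoff indicE; case: (_ \in _); rewrite ?mul1r// mul0r sqn_ge0.
Qed.

Lemma inner_cutoff A f g : inner (cutoff A f) g = inner f (cutoff A g).
Proof.
congr cintegral; apply/funext => x.
by rewrite /cutoff conjcM conjc_real mulrCA mulrA.
Qed.

Lemma cutoff_ae A f g : f = g %[ae mu] -> cutoff A f = cutoff A g %[ae mu].
Proof. by apply: filterS => x fg _; rewrite /cutoff fg. Qed.

Lemma cutoffT f : cutoff setT f = f.
Proof. by apply/funext => x; rewrite /cutoff indicT mul1r. Qed.

End cutoff.

(** * The reproducing kernel and traces of the concentration operator *)

Section projection.
Context {R : realType} {d : nat}.
Local Notation T := (euclid R d).
Local Notation mu := (leb R d).
Variables (Kop : operator R d) (L : set (T -> R[i])) (S0 : set T) (K : T -> T -> R[i]).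
Hypothesis hproj : orthogonal_projection Kop L.
Hypothesis hkernel : projection_kernel Kop L S0 K.
Implicit Types (A B : set T) (f g : T -> R[i]).

Lemma L2_subspace f : L f -> L2 f.
Proof. by case: hproj => _ [[h _ _ _] _]; exact: h. Qed.

Lemma L2_proj f : L2 f -> L2 (Kop f).
Proof. by case: hproj => -[h _ _ _] _; exact: h. Qed.

(** The residual of f is orthogonal to [L], and the projection of g agrees almost everywhere with an
    element of [L]. *)
Lemma proj_inner f g : L2 f -> L2 g -> inner (Kop f) (Kop g) = inner f (Kop g).
Proof.
move=> Lf Lg; have [_ [_ H]] := hproj.
have [[l Ll gl] _] := H g Lg; have [_ /(_ l Ll)] := H f Lf.
have Kf := L2_proj Lf; have Kg := L2_proj Lg; have Ll2 := L2_subspace Ll.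
rewrite -(inner_ae (L2B Lf Kf) (L2B Lf Kf) Kg Ll2 (ae_eq_refl _ _ _) gl).
by rewrite innerBl// => /eqP; rewrite subr_eq0 => /eqP <-.
Qed.

Lemma proj_sym f g : L2 f -> L2 g -> inner (Kop f) g = inner f (Kop g).
Proof.
move=> Lf Lg; have Kf := L2_proj Lf; have Kg := L2_proj Lg.
by rewrite (inner_conj Lg Kf) -proj_inner// -inner_conj// proj_inner.
Qed.

Lemma proj_idem_inner f g : L2 f -> L2 g -> inner (Kop f) (Kop g) = inner (Kop f) g.
Proof. by move=> Lf Lg; rewrite proj_inner// proj_sym. Qed.

Lemma ae_S0 : {ae mu, forall x, S0 x}.
Proof.
have [mS S0'] := kernel_domain hkernel.
by exists (~` S0); split => //; exact: measurableC.
Qed.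

Lemma L2_section x : S0 x -> L2 (K ^~ x).
Proof. by move=> /(kernel_section hkernel)/L2_subspace. Qed.

Lemma kernel_inner x y : S0 x -> S0 y -> K y x = inner (K ^~ x) (K ^~ y).
Proof. by move=> Sx Sy; apply: (kernel_reproducing hkernel) => //; exact: kernel_section hkernel _ Sx. Qed.

Lemma kernel_hermitian x y : S0 x -> S0 y -> K x y = (K y x)^*%C.
Proof. by move=> Sx Sy; rewrite !kernel_inner// -inner_conj//; exact: L2_section. Qed.

Lemma kernel_diag x : S0 x -> K x x = (nn (K ^~ x))%:C%C.
Proof. by move=> Sx; rewrite kernel_inner// inner_diag//; exact: L2_section. Qed.

Lemma cmeasurable_row x : cmeasurable (K x).
Proof. exact: (cmeasurable_comp (pair1_measurable x) (kernel_measurable hkernel)). Qed.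

(** The kernel is Hermitian on [S0], so integrating against the row [K x] is taking the inner
    product with the section [K ^~ x]. *)
Lemma proj_pointwise f : L2 f -> {ae mu, forall x, Kop f x = inner f (K ^~ x)}.
Proof.
move=> Lf; apply: filterS2 ae_S0 (kernel_integral hkernel Lf) => x Sx /(_ I) ->.
apply: cintegral_ae.
- by apply: cmeasurableM; [exact: cmeasurable_row|exact: L2_cmeasurable].
- by apply: cmeasurable_mulconj; apply: L2_cmeasurable => //; exact: L2_section.
- by apply: filterS ae_S0 => y Sy _; rewrite mulrC kernel_hermitian.
Qed.

Lemma proj_cutoff_pointwise A f : measurable A -> L2 f ->
  {ae mu, forall x, sqn (Kop (cutoff A f) x) = sqn (inner (cutoff A (K ^~ x)) f)}.
Proof.
move=> mA Lf; apply: filterS2 ae_S0 (proj_pointwise (L2_cutoff mA Lf)) => x Sx ->.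
have Lx := L2_section Sx.
by rewrite inner_cutoff (inner_conj (L2_cutoff mA Lx) Lf) sqn_conj.
Qed.

(** The value at x obtained by summing |K(1_A e_k)(x)|^2 over an orthonormal basis. *)
Definition section_mass A x := nsq (cutoff A (K ^~ x)).

Lemma measurable_kernel_weight A : measurable A -> measurable_fun setT
  (fun p : T * T => (\1_A p.2 * sqn (K p.2 p.1))%:E).
Proof.
move=> mA; apply/measurable_EFinP; apply: measurable_funM.
  by apply: measurableT_comp; [exact: measurable_indic|exact: measurable_snd].
have sw : measurable_fun setT (fun p : T * T => (p.2, p.1)).
  exact: measurable_fun_pair measurable_snd measurable_fst.
exact: (measurable_sqn (cmeasurable_comp sw (kernel_measurable hkernel))).
Qed.

Lemma kernel_weight_ge0 A (p : T * T) : (0 <= (\1_A p.2 * sqn (K p.2 p.1))%:E)%E.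
Proof. by rewrite lee_fin mulr_ge0 ?sqn_ge0// indicE. Qed.

Lemma section_massE A x :
  section_mass A x = (\int[mu]_y (\1_A y * sqn (K y x))%:E)%E.
Proof. by apply: eq_integral => y _; rewrite sqn_cutoff. Qed.

Lemma measurable_section_mass A : measurable A -> measurable_fun setT (section_mass A).
Proof.
move=> mA.
rewrite (_ : section_mass A = fun x => \int[mu]_y (\1_A y * sqn (K y x))%:E)%E; last first.
  by apply/funext => x; exact: section_massE.
exact: (measurable_fun_fubini_tonelli_F _ (measurable_kernel_weight mA) (@kernel_weight_ge0 A)).
Qed.

Hypothesis hdiag : {ae mu, forall x, K x x = 1}.

Lemma ae_nn_section : {ae mu, forall x, nn (K ^~ x) = 1}.
Proof.
apply: filterS2 ae_S0 hdiag => x Sx; rewrite kernel_diag// => -[]//.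
Qed.

(** After Tonelli the inner integral of |K(y,x)|^2 in x is, by Hermitian symmetry, ||K_y||^2 =
    K(y,y) = 1. *)
Lemma integral_section_mass A : measurable A ->
  (\int[mu]_x section_mass A x = mu A)%E.
Proof.
move=> mA; under eq_integral do rewrite section_massE.
rewrite (fubini_tonelli (fun p : T * T => (\1_A p.2 * sqn (K p.2 p.1))%:E)
  (measurable_kernel_weight mA) (@kernel_weight_ge0 A)) /=.
transitivity (\int[mu]_y (\1_A y)%:E)%E; last by rewrite integral_indic// setIT.
have mS y : measurable_fun setT (fun x => (sqn (K y x))%:E).
  by apply: measurable_sqnE; exact: cmeasurable_row.
apply: ge0_ae_eq_integral => //.
- exact: (measurable_fun_fubini_tonelli_G _ (measurable_kernel_weight mA) (@kernel_weight_ge0 A)).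
- by apply/measurable_EFinP; exact: measurable_indic.
- by move=> y _; apply: integral_ge0 => x _; exact: (@kernel_weight_ge0 A (x, y)).
apply: filterS2 ae_S0 ae_nn_section => y Sy ny _.
under eq_integral do rewrite EFinM.
rewrite ge0_integralZl_EFin//; last by move=> x _; rewrite lee_fin sqn_ge0.
rewrite -[RHS]mule1 -ny; congr (_ * _)%E.
rewrite -L2_fin; last exact: L2_section.
apply: ge0_ae_eq_integral => //; last 2 first.
- by move=> x _; rewrite lee_fin sqn_ge0.
- by apply: filterS ae_S0 => x Sx _; rewrite kernel_hermitian// sqn_conj.
- by apply: measurable_sqnE; exact: L2_cmeasurable (L2_section Sy).
- by move=> x _; rewrite lee_fin sqn_ge0.
Qed.

Lemma L2_proj_cutoff A f : measurable A -> L2 f -> L2 (Kop (cutoff A f)).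
Proof. by move=> mA Lf; apply: L2_proj; exact: L2_cutoff. Qed.

(* The integral of |K|^2 over A x A. *)
Definition pair_mass A : \bar R := (\int[mu]_x ((\1_A x)%:E * section_mass A x))%E.

Lemma nsq_cutoffE B g : nsq (cutoff B g) = (\int[mu]_x ((\1_B x)%:E * (sqn (g x))%:E))%E.
Proof. by apply: eq_integral => x _; rewrite sqn_cutoff EFinM. Qed.

(** Parseval for 1_A K_x at almost every x, then integration over B. Taking B to be the whole space
    gives Tr M; taking B = A gives Tr M^2. *)
Lemma integral_weighted_mass A B e : measurable A -> measurable B -> orthonormal_basis e ->
  (\sum_(0 <= k <oo) nsq (cutoff B (Kop (cutoff A (e k)))))%E =
  (\int[mu]_x ((\1_B x)%:E * section_mass A x))%E.
Proof.
move=> mA mB eb; have Le k : L2 (e k) by case: eb => -[].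
have LK k := L2_cmeasurable (L2_proj_cutoff mA (Le k)).
have mI : measurable_fun setT (fun x : T => (\1_B x : R)%:E).
  by apply/measurable_EFinP; exact: measurable_indic.
have m1 k : measurable_fun setT (fun x => ((\1_B x : R)%:E * (sqn (Kop (cutoff A (e k)) x))%:E)%E).
  by apply: emeasurable_funM => //; exact: measurable_sqnE.
have p1 k x : (0 <= (\1_B x : R)%:E * (sqn (Kop (cutoff A (e k)) x))%:E)%E.
  by rewrite mule_ge0 ?lee_fin ?sqn_ge0// indicE.
under eq_eseriesr do rewrite nsq_cutoffE.
rewrite -integral_nneseries//.
apply: ge0_ae_eq_integral => //.
- by apply: ge0_emeasurable_sum => // k x _ _; exact: p1.
- by apply: emeasurable_funM => //; exact: measurable_section_mass.
- by move=> x _; apply: nneseries_ge0 => k _ _; exact: p1.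
- by move=> x _; rewrite mule_ge0 ?lee_fin ?nsq_ge0// indicE.
(* The pointwise formula has an exceptional set for each k; countably many null sets are discarded
   together. *)
have H : {ae mu, forall x, forall k,
    sqn (Kop (cutoff A (e k)) x) = sqn (inner (cutoff A (K ^~ x)) (e k))}.
  by apply: ae_foralln => k; exact: proj_cutoff_pointwise.
apply: filterS2 ae_S0 H => x Sx Hx _.
rewrite nneseriesZl; last by move=> k _; rewrite lee_fin sqn_ge0.
congr (_ * _)%E; under eq_eseriesr do rewrite Hx.
by apply: Parseval => //; apply: L2_cutoff => //; exact: L2_section.
Qed.

Lemma sum_proj_cutoff_basis A e : measurable A -> orthonormal_basis e ->
  (\sum_(0 <= k <oo) nsq (Kop (cutoff A (e k))))%E = mu A.
Proof.
move=> mA eb; rewrite -integral_section_mass//.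
under eq_eseriesr do rewrite -[Kop _]cutoffT.
rewrite integral_weighted_mass//; apply: eq_integral => x _.
by rewrite indicT mul1e.
Qed.

(** Bessel takes the place of Parseval, so the bound applies to the eigenfunctions, which may be
    incomplete. *)
Lemma sum_proj_cutoff_le A e n : measurable A -> Defs.orthonormal e ->
  (\sum_(0 <= k < n) nsq (Kop (cutoff A (e k))) <= mu A)%E.
Proof.
move=> mA [Le on]; rewrite -integral_section_mass//.
have LK k := L2_cmeasurable (L2_proj_cutoff mA (Le k)).
rewrite /nsq -ge0_integral_sum//; last 2 first.
- by move=> k; exact: measurable_sqnE.
- by move=> k x _; rewrite lee_fin sqn_ge0.
apply: ae_ge0_le_integral => //.
- by move=> x _; apply: sume_ge0 => k _; rewrite lee_fin sqn_ge0.
- by apply: emeasurable_sum => k; exact: measurable_sqnE.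
- by move=> x _; exact: nsq_ge0.
- exact: measurable_section_mass.
have H : {ae mu, forall x, forall k,
    sqn (Kop (cutoff A (e k)) x) = sqn (inner (cutoff A (K ^~ x)) (e k))}.
  by apply: ae_foralln => k; exact: proj_cutoff_pointwise.
apply: filterS2 ae_S0 H => x Sx Hx _.
have Lx : L2 (cutoff A (K ^~ x)) by apply: L2_cutoff => //; exact: L2_section.
under eq_bigr do rewrite Hx.
rewrite sumEFin /section_mass L2_fin// lee_fin.
apply: (Bessel (b := fun=> 1) Le Lx) => //; first exact: iota_uniq.
by move=> i j _ _; rewrite on; case: eqP.
Qed.

Lemma inner_concentration A f : measurable A -> L2 f ->
  inner (concentration Kop A f) f = (nn (Kop (cutoff A f)))%:C%C.
Proof.
move=> mA Lf; have LA := L2_cutoff mA Lf; rewrite /concentration /= inner_cutoff.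
by rewrite -proj_idem_inner// inner_diag//; exact: L2_proj.
Qed.

(** Each diagonal entry <M e_k, e_k> equals ||K(1_A e_k)||^2, because K is a self-adjoint
    idempotent. *)
Lemma trace_concentration A (t : R) : measurable A ->
  is_trace (concentration Kop A) t%:C%C -> mu A = t%:E.
Proof.
move=> mA [e eb [+ _]] /=; have Le k : L2 (e k) by case: eb => -[].
rewrite -(sum_proj_cutoff_basis mA eb) => c.
apply/cvg_lim => //; rewrite (_ : (fun n => _) = EFin \o
    (fun n => complex.Re (\sum_(k < n) inner (concentration Kop A (e k)) (e k)))).
  by apply: cvg_EFin => //; exact: nearW.
apply/funext => n /=.
under [X in complex.Re X]eq_bigr do rewrite inner_concentration//.
rewrite -rmorph_sum /= -sumEFin -(big_mkord xpredT (fun k => (nn (Kop (cutoff A (e k))))%:E)).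
by apply: eq_bigr => k _; rewrite L2_fin//; exact: L2_proj_cutoff.
Qed.

Lemma L2_concentration A f : measurable A -> L2 f -> L2 (concentration Kop A f).
Proof. by move=> mA Lf; apply: L2_cutoff => //; exact: L2_proj_cutoff. Qed.

Lemma concentration_sym A f g : measurable A -> L2 f -> L2 g ->
  inner (concentration Kop A f) g = inner f (concentration Kop A g).
Proof.
move=> mA Lf Lg; rewrite /concentration /= inner_cutoff proj_sym ?inner_cutoff//.
  exact: L2_cutoff.
exact: L2_cutoff.
Qed.

(** * Eigenvalues of the concentration operator *)

Section spectral.
Variables (A : set T) (mu_ : nat -> R) (Phi : nat -> T -> R[i]).
Hypothesis mA : measurable A.
Hypothesis sd : spectral_decomposition (concentration Kop A) mu_ Phi.

Let LPhi k : L2 (Phi k). Proof. by case: (spectral_orthonormal sd). Qed.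

Let on i j : inner (Phi i) (Phi j) = if i == j then (1 : R)%:C%C else 0.
Proof. by case: (spectral_orthonormal sd) => _ ->; case: eqP. Qed.

Lemma inner_concentration_eigen f k : L2 f ->
  inner (concentration Kop A f) (Phi k) = (mu_ k)%:C%C * inner f (Phi k).
Proof.
move=> Lf; rewrite concentration_sym//.
rewrite (inner_ae Lf Lf (L2_concentration mA (LPhi k)) (L2Z (mu_ k)%:C%C (LPhi k))
  (ae_eq_refl _ _ _) (spectral_eigen sd k)).
by rewrite innerZr// conjc_real.
Qed.

Lemma nsq_L2norm f : L2 f -> nsq f = (L2norm f * L2norm f)%E.
Proof.
move=> Lf; have [_ foo] := Lf; have N0 : (0 <= L2norm f)%E by exact: Lnorm_ge0.
rewrite -L2norm_sqr; move: foo N0; case: (L2norm f) => [r| |]// _; rewrite lee_fin => r0.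
by rewrite poweR_EFin powR_mulrn// expr2 EFinM.
Qed.

(** Since mu_j <f, Phi_j> = <M f, Phi_j>, the error in the spectral expansion of M f is its Fourier
    residual along [Phi]. That error tends to 0, so Parseval holds for M f even if [Phi] is
    incomplete. *)
Lemma nsq_concentration f : L2 f ->
  nsq (concentration Kop A f) = (\sum_(0 <= j <oo) (mu_ j ^+ 2 * sqn (inner f (Phi j)))%:E)%E.
Proof.
move=> Lf; have LM := L2_concentration mA Lf.
set M := concentration Kop A f in LM *.
pose res n : T -> R[i] := fun x => M x - comb Phi (fun k => inner M (Phi k)) (index_iota 0 n) x.
have Lres n : L2 (res n) by apply: L2B => //; exact: L2_comb.
have c0 : nsq (res n) @[n --> \oo] --> 0%E.
  under eq_fun do rewrite nsq_L2norm//.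
  have c : L2norm (res n) @[n --> \oo] --> 0%E.
    apply: cvg_trans (spectral_expansion sd Lf); apply: near_eq_cvg; apply: nearW => n.
    congr L2norm; apply/funext => x; rewrite /res /comb big_mkord; congr (_ - _).
    by apply: eq_bigr => k _; rewrite inner_concentration_eigen.
  by rewrite -(mule0 0%E); apply: cvgeM => //; rewrite mule0_def.
apply/esym/cvg_lim => //.
rewrite (_ : (fun n => _) = (fun n => nsq M - nsq (res n))%E).
  by rewrite -[X in _ --> X]sube0; apply: cvgeB => //; [rewrite fin_num_adde_defl|exact: cvg_cst].
apply/funext => n; rewrite sumEFin (L2_fin LM) (L2_fin (Lres n)) -EFinB; congr _%:E.
rewrite -/(nn M) -/(nn (res n)) (nn_residual (b := fun=> 1) LPhi)//; last exact: iota_uniq.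
rewrite subKr; apply: eq_bigr => k _; rewrite inner_concentration_eigen// sqnM sqn_real; ring.
Qed.

(** Both sides equal the sum of ||M e_k||^2: after exchanging the sums, the factor of mu_j^2 is the
    sum over k of |<e_k, Phi_j>|^2 = ||Phi_j||^2 = 1. *)
Lemma pair_mass_spectral (e : nat -> T -> R[i]) : orthonormal_basis e ->
  pair_mass A = (\sum_(0 <= j <oo) (mu_ j ^+ 2)%:E)%E.
Proof.
move=> eb; have Le k : L2 (e k) by case: eb => -[].
rewrite /pair_mass -(integral_weighted_mass mA mA eb).
under eq_eseriesr do rewrite -/(concentration Kop A _) nsq_concentration//.
rewrite nneseries_interchange; last by move=> i j; rewrite lee_fin mulr_ge0 ?sqr_ge0 ?sqn_ge0.
apply: eq_eseriesr => j _; under eq_eseriesr do rewrite EFinM.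
rewrite nneseriesZl; last by move=> k _; rewrite lee_fin sqn_ge0.
rewrite -[RHS]mule1; congr (_ * _)%E.
under eq_eseriesr do rewrite (inner_conj (LPhi j) (Le _)) sqn_conj.
rewrite Parseval// L2_fin// -/(nn _) nn_Re// on eqxx//.
Qed.

(** Here mu_j = <M Phi_j, Phi_j> = ||K(1_A Phi_j)||^2. *)
Lemma sum_eigenvalues_le n : ((\sum_(0 <= j < n) mu_ j)%:E <= mu A)%E.
Proof.
apply: le_trans (sum_proj_cutoff_le n mA (spectral_orthonormal sd)).
rewrite -sumEFin; apply: lee_sum => k _.
rewrite L2_fin; last exact: L2_proj_cutoff.
rewrite lee_fin -/(nn _).
have := inner_concentration mA (LPhi k); rewrite inner_concentration_eigen// on eqxx mulr1.
by move=> [->].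
Qed.

End spectral.

(** * Polar decomposition and the functions Psi *)

Section polar.
Variables (A : set T) (mu_ : nat -> R) (Phi Psi : nat -> T -> R[i]) (W : operator R d).
Hypothesis mA : measurable A.
Hypothesis sd : spectral_decomposition (concentration Kop A) mu_ Phi.
Hypothesis pd : polar_decomposition (Kop \o cutoff A) (concentration Kop A) W.
Hypothesis PsiL : forall j, L (Psi j) /\ Psi j = W (Phi j) %[ae mu].

Let LPhi k : L2 (Phi k). Proof. by case: (spectral_orthonormal sd). Qed.
Let LPsi k : L2 (Psi k). Proof. by apply: L2_subspace; case: (PsiL k). Qed.
Let LN k : L2 (Kop (cutoff A (Phi k))). Proof. exact: L2_proj_cutoff. Qed.
Let on i j : inner (Phi i) (Phi j) = if i == j then (1 : R)%:C%C else 0.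
Proof. by case: (spectral_orthonormal sd) => _ ->; case: eqP. Qed.

Lemma Psi_ker j : mu_ j = 0 -> Psi j = cst 0 %[ae mu].
Proof.
move=> m0; have [_ _ Wker] := pd.
have M0 : concentration Kop A (Phi j) = cst 0 %[ae mu].
  by apply: filterS (spectral_eigen sd j) => x /= h _; rewrite h// m0 mul0r.
by apply: filterS2 (PsiL j).2 (Wker _ (LPhi j) M0) => x h1 h2 _; rewrite h1// h2.
Qed.

(* [S = sqrt M] acts on the eigenvector as [sqrt (mu_ j)]: for
   [v = S Phi - sqrt (mu_ j) Phi] one has [S v = - sqrt (mu_ j) v], and [S >= 0]. *)
Lemma sqrt_eigen S j : is_sqrt (concentration Kop A) S -> 0 < mu_ j ->
  S (Phi j) = (fun x => (Num.sqrt (mu_ j))%:C%C * Phi j x) %[ae mu].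
Proof.
move=> [[bS pS] SS] mu_gt0; set s := Num.sqrt (mu_ j).
have s_gt0 : 0 < s by rewrite sqrtr_gt0.
have ss : s ^+ 2 = mu_ j by rewrite sqr_sqrtr// ltW.
have LS := operator_L2 bS (LPhi j).
pose v : T -> R[i] := fun x => (- s)%:C%C * Phi j x + S (Phi j) x.
have Lv : L2 v by apply: L2D => //; exact: L2Z.
have Sv : S v = (fun x => (- s)%:C%C * v x) %[ae mu].
  apply: filterS3 (operator_linear bS (- s)%:C%C (LPhi j) LS) (SS _ (LPhi j))
    (spectral_eigen sd j) => x /= h1 h2 h3 _.
  rewrite h1// h2// h3// /v -ss; apply: complex_ext;
    rewrite !(ReM, ImM, ReD, ImD) /=; ring.
have := pS _ Lv; rewrite (inner_ae (operator_L2 bS Lv) (L2Z (- s)%:C%C Lv) Lv Lv Sv (ae_eq_refl _ _ _)).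
rewrite innerZl// inner_diag// -/(nn v) -rmorphM /= ler0c mulNr oppr_ge0 pmulr_rle0//.
move=> nv; have nv0 : nsq v = 0%E.
  by rewrite L2_fin// -/(nn v); congr _%:E; apply/eqP; rewrite eq_le nv nn_ge0.
apply: filterS (nsq0_ae (L2_cmeasurable Lv) nv0) => x /= /(_ I) vx _.
by apply/eqP; rewrite -subr_eq0 -[X in _ == X]vx /v rmorphN mulNr addrC.
Qed.

(** Apply W to S Phi_j = sqrt(mu_j) Phi_j and use W S = K 1_A. *)
Lemma Psi_polar j : 0 < mu_ j ->
  (fun x => (Num.sqrt (mu_ j))%:C%C * Psi j x) = Kop (cutoff A (Phi j)) %[ae mu].
Proof.
move=> mu_gt0; have [bW [S sS WS] _] := pd.
set s : R[i] := (Num.sqrt (mu_ j))%:C%C.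
have LS := operator_L2 sS.1.1 (LPhi j).
(* Linearity of operators is available for combinations a f + g, hence the splitting s = (s - 1) +
   1. *)
have h : S (Phi j) = (fun x => (s - 1) * Phi j x + Phi j x) %[ae mu].
  by apply: filterS (sqrt_eigen sS mu_gt0) => x h /h ->; rewrite mulrBl mul1r subrK.
have L' : L2 (fun x => (s - 1) * Phi j x + Phi j x) by apply: L2D => //; exact: L2Z.
have h2 := operator_ae bW LS L' h.
have h3 := operator_linear bW (s - 1) (LPhi j) (LPhi j).
have h4 := WS _ (LPhi j).
have h23 := ae_eq_trans h2 h3; have h234 := ae_eq_trans (ae_eq_sym h23) h4.
apply: filterS2 (PsiL j).2 h234 => x /= e1 e2 _.
by rewrite e1// -e2// mulrBl mul1r subrK.
Qed.

Let mu_ge0 j : 0 <= mu_ j. Proof. by case/andP: (spectral_range sd j). Qed.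

Let mu0P j : mu_ j = 0 \/ 0 < mu_ j.
Proof. by have := mu_ge0 j; rewrite le_eqVlt => /orP[/eqP <-|]; [left|right]. Qed.

(** For positive eigenvalues, sqrt(mu_i mu_j) <Psi_i, Psi_j> = <K 1_A Phi_i, K 1_A Phi_j> = <M
    Phi_i, Phi_j>, which is mu_i if i = j and 0 otherwise. For a zero eigenvalue W kills [Phi] and
    the squared norm is 0. *)
Lemma Psi_orthonormal i j :
  inner (Psi i) (Psi j) = if i == j then ((0 < mu_ i)%R%:R : R)%:C%C else 0.
Proof.
have [mi|mi] := mu0P i.
  rewrite (inner_ae (LPsi i) L2_0 (LPsi j) (LPsi j) (Psi_ker mi) (ae_eq_refl _ _ _)).
  by rewrite inner0l// mi ltxx; case: ifP.
have [mj|mj] := mu0P j.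
  rewrite (inner_conj (LPsi j) (LPsi i)).
  rewrite (inner_ae (LPsi j) L2_0 (LPsi i) (LPsi i) (Psi_ker mj) (ae_eq_refl _ _ _)).
  rewrite inner0l// conjc0; case: eqP => // ij; move: mi; rewrite ij mj ltxx//.
have si : (Num.sqrt (mu_ i))%:C%C != 0 :> R[i].
  by rewrite (inj_eq (@complexI R)) gt_eqF// sqrtr_gt0.
have sj : (Num.sqrt (mu_ j))%:C%C != 0 :> R[i].
  by rewrite (inj_eq (@complexI R)) gt_eqF// sqrtr_gt0.
apply: (mulfI si); apply: (mulfI sj).
rewrite -innerZl// -{1}[(Num.sqrt (mu_ j))%:C%C]conjc_real -innerZr//; last exact: L2Z.
rewrite (inner_ae (L2Z _ (LPsi i)) (LN i) (L2Z _ (LPsi j)) (LN j) (Psi_polar mi) (Psi_polar mj)).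
rewrite proj_idem_inner//; try exact: L2_cutoff.
rewrite -inner_cutoff -/(concentration Kop A (Phi i)) (inner_concentration_eigen mA sd)// on.
case: eqP => [->|_]; last by rewrite !mulr0.
by rewrite mj !mulr1 -rmorphM /= -expr2 sqr_sqrtr.
Qed.

Lemma nsq_Psi j : (nsq (Psi j) <= 1)%E.
Proof.
rewrite L2_fin// lee_fin -/(nn _) nn_Re// Psi_orthonormal eqxx /=.
by rewrite lern1 leq_b1.
Qed.

(** Cutting [Psi_polar] off to A gives sqrt(mu_j) 1_A Psi_j = M Phi_j = mu_j Phi_j; compare squared
    norms and divide by mu_j when it is positive. *)
Lemma nsq_cutoff_Psi j : nsq (cutoff A (Psi j)) = (mu_ j)%:E.
Proof.
have mPsi := L2_cmeasurable (LPsi j); have mPhi := L2_cmeasurable (LPhi j).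
have [m0|m_gt0] := mu0P j.
  rewrite (nsq_ae (cmeasurable_cutoff mA mPsi) (cmeasurable_cutoff mA (cmeasurable_cst 0))
    (cutoff_ae A (Psi_ker m0))) m0 /nsq.
  by under eq_integral do rewrite /cutoff mulr0 sqn0; rewrite integral0.
have h : nsq (cutoff A (fun x => (Num.sqrt (mu_ j))%:C%C * Psi j x)) =
         nsq (fun x => (mu_ j)%:C%C * Phi j x).
  apply: nsq_ae.
  - by apply: cmeasurable_cutoff => //; apply: L2_cmeasurable; exact: L2Z.
  - by apply: L2_cmeasurable; exact: L2Z.
  - exact: ae_eq_trans (cutoff_ae A (Psi_polar m_gt0)) (spectral_eigen sd j).
have nPhi : nsq (Phi j) = 1%E by rewrite L2_fin// -/(nn _) nn_Re// on eqxx.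
rewrite nsqZ// nPhi mule1 sqn_real in h.
have E : cutoff A (fun x => (Num.sqrt (mu_ j))%:C%C * Psi j x) =
    (fun x => (Num.sqrt (mu_ j))%:C%C * cutoff A (Psi j) x).
  by apply/funext => x; rewrite /cutoff mulrCA.
rewrite E nsqZ ?sqn_real ?sqr_sqrtr// in h; last exact: cmeasurable_cutoff.
rewrite (L2_fin (L2_cutoff mA (LPsi j))) in h *.
move: h; rewrite -EFinM => -[]; rewrite expr2 => h.
by congr _%:E; apply: (mulfI _ h); rewrite gt_eqF.
Qed.

Lemma ae_sum_Psi_le n : {ae mu, forall x, \sum_(0 <= j < n) sqn (Psi j x) <= 1}.
Proof.
apply: filterS2 ae_S0 ae_nn_section => x Sx nx; have Lx := L2_section Sx; rewrite -nx.
under eq_bigr => j _ do rewrite (kernel_reproducing hkernel (PsiL j).1 Sx)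
  (inner_conj Lx (LPsi j)) sqn_conj.
apply: (Bessel (b := fun i => (0 < mu_ i)%R%:R) LPsi Lx); first exact: iota_uniq.
  by move=> i j _ _; exact: Psi_orthonormal.
by move=> k _; rewrite lern1 leq_b1.
Qed.

End polar.

(** Indices start at 0, so m_N is the largest discarded term. The discarded squares sum to at most
    m_N times the discarded mass, which is at most t minus the kept sum, hence at most the sum of 1
    - m_j over j < N as t <= N. Since m_N <= m_j there, this is at most the sum of m_j - m_j^2 over
    the kept indices. *)
Lemma truncated_eigenvalue_sum (m : nat -> R) (N : nat) (t q : R) :
  (forall j, m j.+1 <= m j) -> (forall j, 0 <= m j <= 1) -> t <= N%:R ->
  (forall n, \sum_(0 <= j < n) m j <= t) ->
  (q%:E <= \sum_(0 <= j <oo) (m j ^+ 2)%:E)%E ->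
  q <= \sum_(0 <= j < N) m j.
Proof.
move=> mS m01 tN mt qm; rewrite -lee_fin; apply: le_trans qm _.
apply: lime_le; first by apply: is_cvg_nneseries => j _ _; rewrite lee_fin sqr_ge0.
exists N => // n /= Nn; rewrite sumEFin lee_fin.
rewrite (big_cat_nat (leq0n N) Nn) /=.
have m_ge0 j : 0 <= m j by case/andP: (m01 j).
have m_le1 j : m j <= 1 by case/andP: (m01 j).
have mono i j : (i <= j)%N -> m j <= m i.
  by move=> ij; rewrite -(subnKC ij); elim: (j - i)%N => [|k IH]; rewrite ?addn0// addnS (le_trans _ IH).
have tail : \sum_(N <= j < n) m j ^+ 2 <= m N * \sum_(N <= j < n) m j.
  rewrite mulr_sumr big_nat_cond [leRHS]big_nat_cond; apply: ler_sum => j /andP[/andP[Nj _] _].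
  by rewrite expr2 ler_wpM2r// mono.
have tailt : \sum_(N <= j < n) m j <= \sum_(0 <= j < N) (1 - m j).
  have := mt n; rewrite (big_cat_nat (leq0n N) Nn) /= sumrB big_const_nat subn0.
  rewrite iter_addr addr0; lra.
have head : m N * \sum_(0 <= j < N) (1 - m j) <= \sum_(0 <= j < N) m j * (1 - m j).
  rewrite mulr_sumr big_nat_cond [leRHS]big_nat_cond; apply: ler_sum => j /andP[/andP[_ jN] _].
  by rewrite ler_wpM2r ?subr_ge0// mono// ltnW.
have h1 : m N * \sum_(N <= j < n) m j <= m N * \sum_(0 <= j < N) (1 - m j) by rewrite ler_wpM2l.
have -> : \sum_(0 <= j < N) m j = \sum_(0 <= j < N) m j ^+ 2 + \sum_(0 <= j < N) m j * (1 - m j).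
  by rewrite -big_split /=; apply: eq_bigr => j _; ring.
by rewrite lerD2l (le_trans tail)// (le_trans h1).
Qed.

Lemma pair_mass_le A : measurable A -> (pair_mass A <= mu A)%E.
Proof.
move=> mA; rewrite -integral_section_mass//; apply: ge0_le_integral => //.
- by move=> x _; rewrite mule_ge0 ?nsq_ge0// lee_fin indicE.
- apply: emeasurable_funM; last exact: measurable_section_mass.
  by apply/measurable_EFinP; exact: measurable_indic.
- exact: measurable_section_mass.
- move=> x _; rewrite indicE; case: (x \in A); rewrite ?mul1e// mul0e.
  exact: nsq_ge0.
Qed.

Lemma pair_mass_ge0 A : (0 <= pair_mass A)%E.
Proof. by apply: integral_ge0 => x _; rewrite mule_ge0 ?nsq_ge0// lee_fin indicE. Qed.

Lemma acc_spectrogram_L1 A (rho : T -> R) : measurable A -> acc_spectrogram Kop L A rho ->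
  [/\ measurable_fun setT rho, mu.-integrable setT (EFin \o rho) &
   (\int[mu]_x (`|rho x - \1_A x|)%:E <= 2%:E * (mu A - pair_mass A) + 1)%E].
Proof.
move=> mA [m [Phi [Psi [W [t [N [sd pd PsiL [tr NE] rhoE]]]]]]].
have At := trace_concentration mA tr.
have LPsi k : L2 (Psi k) by apply: L2_subspace; case: (PsiL k).
have mPsi k : measurable_fun setT (fun x => (sqn (Psi k x))%:E).
  by apply: measurable_sqnE; exact: L2_cmeasurable.
(* The basis that witnesses the trace also serves to evaluate Tr M^2. *)
have [e eb _] := tr.
have {}rhoE : rho = (fun x => \sum_(0 <= j < N) sqn (Psi j x)).
  by apply/funext => x; rewrite rhoE big_mkord; apply: eq_bigr => j _; rewrite normc_sqr.
have rho0 x : 0 <= rho x by rewrite rhoE; apply: sumr_ge0 => j _; exact: sqn_ge0.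
have mrho : measurable_fun setT rho.
  rewrite rhoE; apply: measurable_sum => j.
  by apply: measurable_sqn; exact: L2_cmeasurable.
have mrhoE : measurable_fun setT (EFin \o rho) by exact/measurable_EFinP.
have Irho : (\int[mu]_x (rho x)%:E <= N%:R%:E)%E.
  rewrite rhoE; under eq_integral do rewrite -sumEFin.
  rewrite ge0_integral_sum//; last by move=> j x _; rewrite lee_fin sqn_ge0.
  apply: (@le_trans _ _ (\sum_(0 <= j < N) 1)%E).
    by apply: lee_sum => j _; exact: (nsq_Psi mA sd pd PsiL).
  by rewrite sumEFin big_const_nat subn0 iter_addr addr0.
have Irho0 : (0 <= \int[mu]_x (rho x)%:E)%E by apply: integral_ge0 => x _; rewrite lee_fin.
have mI : measurable_fun setT (\1_A : T -> R) by exact: measurable_indic.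
have IArho : (\int[mu]_x (\1_A x * rho x)%:E = (\sum_(0 <= j < N) m j)%:E)%E.
  rewrite rhoE; under eq_integral do rewrite mulr_sumr -sumEFin.
  rewrite ge0_integral_sum//; last 2 first.
  - move=> j; apply/measurable_EFinP; apply: measurable_funM => //.
    by apply: measurable_sqn; exact: L2_cmeasurable.
  - by move=> j x _; rewrite lee_fin mulr_ge0 ?sqn_ge0// indicE.
  rewrite -sumEFin; apply: eq_bigr => j _; rewrite -(nsq_cutoff_Psi mA sd pd PsiL).
  by apply: eq_integral => x _; rewrite sqn_cutoff.
have IA : (\int[mu]_x (\1_A x)%:E = t%:E)%E by rewrite integral_indic// setIT.
have irho : mu.-integrable setT (EFin \o rho).
  apply/integrableP; split => //=.
  under eq_integral do rewrite ger0_norm//.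
  by apply: le_lt_trans Irho _; rewrite ltry.
split => //.
have rho1 : {ae mu, forall x, rho x <= 1}.
  by rewrite rhoE; exact: (ae_sum_Psi_le mA sd pd PsiL).
have mIrho : measurable_fun setT (fun x => (2%:E * (\1_A x * rho x)%:E)%E).
  by apply: measurable_funeM; apply/measurable_EFinP; exact: measurable_funM.
have mdiff : measurable_fun setT (fun x => (`|rho x - \1_A x|)%:E).
  by apply/measurable_EFinP; apply: measurableT_comp => //; exact: measurable_funB.
have mIE : measurable_fun setT (fun x => (\1_A x : R)%:E) by exact/measurable_EFinP.
have I0 x : 0 <= \1_A x :> R by rewrite indicE.
(* Integrates |rho - 1_A| + 2 1_A rho = 1_A + rho, valid where 0 <= rho <= 1. The additive form
   avoids subtracting extended reals. *)
have key : (\int[mu]_x (`|rho x - \1_A x|)%:E + 2%:E * \int[mu]_x (\1_A x * rho x)%:E =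
    \int[mu]_x (\1_A x)%:E + \int[mu]_x (rho x)%:E)%E.
  rewrite -ge0_integralZl_EFin//; last 2 first.
  - by move=> x _; rewrite lee_fin mulr_ge0.
  - by apply/measurable_EFinP; exact: measurable_funM.
  rewrite -ge0_integralD//; last by move=> x _; rewrite -EFinM lee_fin !mulr_ge0.
  rewrite -ge0_integralD//; last by move=> x _; rewrite lee_fin.
  apply: ge0_ae_eq_integral => //.
  - exact: emeasurable_funD.
  - exact: emeasurable_funD.
  - by move=> x _; rewrite -EFinM -EFinD lee_fin addr_ge0// !mulr_ge0.
  - by move=> x _; rewrite -EFinD lee_fin addr_ge0.
  apply: filterS rho1 => x rx _; rewrite -EFinM -!EFinD; congr _%:E.
  rewrite indicE; case: (x \in A); rewrite /=.
    by rewrite ler0_norm ?subr_le0//; ring.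
  by rewrite subr0 ger0_norm//; ring.
have pm_fin : pair_mass A = (fine (pair_mass A))%:E.
  rewrite fineK// ge0_fin_numE ?pair_mass_ge0//.
  by apply: le_lt_trans (pair_mass_le mA) _; rewrite At ltry.
have tN : t <= N%:R.
  by have := ceil_ge t; rewrite -NE.
have Nt : N%:R <= t + 1.
  by have := ceilB1_lt t; rewrite -NE intrB /= ltrBlDr => /ltW.
have qm : fine (pair_mass A) <= \sum_(0 <= j < N) m j.
  apply: (truncated_eigenvalue_sum (spectral_noninc sd) (spectral_range sd) tN).
    by move=> n; rewrite -lee_fin -At; exact: (sum_eigenvalues_le mA sd).
  by rewrite -pm_fin (pair_mass_spectral mA sd eb).
have Dlt : (\int[mu]_x (`|rho x - \1_A x|)%:E < +oo)%E.
  apply: (@le_lt_trans _ _ (t%:E + N%:R%:E)%E); last by rewrite ltry.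
  rewrite -IA; apply: (@le_trans _ _ (\int[mu]_x (\1_A x)%:E + \int[mu]_x (rho x)%:E)%E).
    by rewrite -key leeDl// IArho -EFinM lee_fin mulr_ge0// sumr_ge0// => j _; case/andP: (spectral_range sd j).
  by rewrite leeD2l.
have D0 : (0 <= \int[mu]_x (`|rho x - \1_A x|)%:E)%E by apply: integral_ge0 => x _; rewrite lee_fin.
have Jfin : (\int[mu]_x (rho x)%:E)%E \is a fin_num.
  by rewrite ge0_fin_numE//; apply: le_lt_trans Irho _; rewrite ltry.
move: key Irho; rewrite IArho IA At pm_fin.
have /fineK <- : (\int[mu]_x (`|rho x - \1_A x|)%:E)%E \is a fin_num by rewrite ge0_fin_numE.
rewrite -(fineK Jfin).
rewrite -EFinB -!EFinM -!EFinD !lee_fin => -[].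
(* D = t - 2 S + J, with S >= Q and J <= N <= t + 1. *)
set D := fine _; set J := fine _; set S := \sum_(_ <= _ < _) _ in qm *; lra.
Qed.
End projection.

(** * Counting points of a determinantal process *)

Lemma esum_indicator_seq {R : realType} {T : choiceType} (S : set T) (f : T -> \bar R) (l : seq T) :
  uniq l -> (forall z, z \in l -> S z) ->
  (forall z, S z -> f z = if z \in l then 1%E else 0%E) ->
  \esum_(z in S) f z = (size l)%:R%:E.
Proof.
move=> ul lS fl; rewrite (eq_esum (b := fun z => if z \in [set` l] then 1%E else 0%E)); last first.
  by move=> z Sz; rewrite fl// (_ : (z \in [set` l]) = (z \in l))//; apply/idP/idP; rewrite inE.
rewrite -esum_mkcondr (_ : S `&` [set` l] = [set` l]); last first.
  by apply/seteqP; split=> z /=; [case|move=> zl; split => //; exact: lS].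
rewrite esum_fset//.
rewrite -fsbig_seq// sumEFin big_const_seq count_predT.
by rewrite iter_addr addr0.
Qed.

(* [f] need not be measurable: sums over the support of a configuration are only
   almost surely equal to a measurable function. *)
Lemma ge0_ae_integral {dsp : measure_display} {T : measurableType dsp} {R : realType}
    (m : {measure set T -> \bar R}) (f g : T -> \bar R) :
  (forall x, 0 <= f x)%E -> (forall x, 0 <= g x)%E -> measurable_fun setT g ->
  f = g %[ae m] -> (\int[m]_x f x = \int[m]_x g x)%E.
Proof.
move=> f0 g0 mg [N [mN N0 fgN]].
have fg x : ~ N x -> f x = g x.
  by move=> nNx; apply: contrapT => h; apply: nNx; apply: fgN => /= /(_ I).
(* As a supremum over simple functions below the integrand, the integral is monotone without
   measurability. It remains to squeeze f between [lo] and [hi], measurable modifications of g by 0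
   and +oo on the null set. *)
have mono (u v : T -> \bar R) : (forall x, 0 <= u x)%E -> (forall x, u x <= v x)%E ->
    (\int[m]_x u x <= \int[m]_x v x)%E.
  move=> u0 uv; have v0 x : (0 <= v x)%E by exact: le_trans (u0 x) (uv x).
  rewrite !ge0_integralTE//; apply: ge_ereal_sup => _ [h hu <-].
  by apply: ereal_sup_ubound; exists h => // x; exact: le_trans (hu x) (uv x).
pose lo x := (g x * (\1_(~` N) x)%:E)%E.
pose hi x := (g x + +oo * (\1_N x)%:E)%E.
have mI (B : set T) : measurable B -> measurable_fun setT (fun x => (\1_B x : R)%:E).
  by move=> mB; apply/measurable_EFinP; exact: measurable_indic.
have mlo : measurable_fun setT lo.
  by apply: emeasurable_funM => //; apply: mI; exact: measurableC.
have mhi : measurable_fun setT hi.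
  by apply: emeasurable_funD => //; apply: emeasurable_funM; [exact: measurable_cst|exact: mI].
have aeN (u : T -> \bar R) : (forall x, ~ N x -> u x = g x) -> u = g %[ae m].
  by move=> ug; exists N; split => // x; apply: contra_notP => nNx _; exact: ug.
have loN x : ~ N x -> lo x = g x by move=> nNx; rewrite /lo indicE mem_set// mule1.
have hiN x : ~ N x -> hi x = g x by move=> nNx; rewrite /hi indicE memNset// mule0 adde0.
have lo0 x : (0 <= lo x)%E by rewrite /lo mule_ge0// lee_fin indicE.
have hi0 x : (0 <= hi x)%E by rewrite /hi adde_ge0// mule_ge0// lee_fin indicE.
have lo_g : (\int[m]_x lo x = \int[m]_x g x)%E by apply: ge0_ae_eq_integral => //; exact: aeN.
have hi_g : (\int[m]_x hi x = \int[m]_x g x)%E by apply: ge0_ae_eq_integral => //; exact: aeN.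
apply/eqP; rewrite eq_le -{1}hi_g -lo_g; apply/andP; split; apply: mono => // x.
  have [Nx|nNx] := pselect (N x); last by rewrite hiN// fg.
  by rewrite /hi indicE mem_set// mule1 addey ?leey// gt_eqF// (lt_le_trans _ (g0 x)).
have [Nx|nNx] := pselect (N x); last by rewrite loN// fg.
by rewrite /lo indicE memNset ?mule0//; apply.
Qed.

(** * Simple configurations as counting measures of their supports *)

Section configurations.
Context {R : realType} {d : nat}.
Local Notation T := (euclid R d).
Implicit Types (Xi : config R d) (A : set T).

Lemma measurable_cube (x : T) (e : R) : measurable (cube x e).
Proof.
rewrite (_ : cube x e = \bigcap_(i in [set: 'I_d])
    ((fun y : T => tnth y i) @^-1` `](tnth x i - e), (tnth x i + e)[)); last first.
  apply/seteqP; split=> y /= h i.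
    by move=> _ /=; rewrite in_itv /= -ltr_distl.
  by have := h i I; rewrite /= in_itv /= -ltr_distl.
apply: fin_bigcap_measurable => // i _.
by rewrite -[X in measurable X]setTI; apply: measurable_tnth.
Qed.

Lemma cube_bigcap (x : T) : [set x] = \bigcap_k cube x k.+1%:R^-1.
Proof.
apply/seteqP; split=> [y ->|y h] /=; first by move=> k _ i; rewrite subrr normr0.
apply: eq_from_tnth => i; apply/eqP; rewrite -subr_eq0 -normr_le0.
rewrite leNgt; apply/negP => y0; have [k _ /(_ k (leqnn _))] := @near_infty_natSinv_lt R (PosNum y0).
by move=> /= hk; have := h k I i; rewrite ltNge (ltW hk).
Qed.

Lemma measurable_point (x : T) : measurable [set x].
Proof.
by rewrite cube_bigcap; apply: bigcapT_measurable => k; exact: measurable_cube.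
Qed.

Lemma bounded_cube (x : T) (e : R) : bounded_subset (cube x e).
Proof.
exists (\sum_i `|tnth x i| + e) => y h i.
rewrite -(subrK (tnth x i) (tnth y i)) addrC; apply: le_trans (ler_normD _ _) _.
apply: lerD; last exact/ltW/h.
by rewrite (bigD1 i)//= lerDl sumr_ge0.
Qed.

Lemma config_gt0_ge1 Xi A : measurable A -> bounded_subset A -> (0 < Xi A -> 1 <= Xi A)%E.
Proof.
move=> mA bA; have [k ->] := config_nat Xi mA bA.
by rewrite lte_fin lee_fin ltr0n ler1n.
Qed.

Lemma config_fin Xi A : measurable A -> bounded_subset A -> (Xi A < +oo)%E.
Proof. by move=> mA bA; have [k ->] := config_nat Xi mA bA; rewrite ltry. Qed.

(** Every cube around x has positive integer mass, hence mass at least 1; this passes to the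
    intersection by continuity from above. *)
Lemma supp_point_ge1 Xi x : supp Xi x -> (1 <= Xi [set x])%E.
Proof.
move=> Sx; have H : (Xi \o (fun k => cube x k.+1%:R^-1)) k @[k --> \oo] --> Xi [set x].
  rewrite cube_bigcap; apply: nonincreasing_cvg_mu.
  - by apply: config_fin; [exact: measurable_cube|exact: bounded_cube].
  - by move=> k; exact: measurable_cube.
  - by rewrite -cube_bigcap; exact: measurable_point.
  - move=> n m nm; apply/subsetPset => y h i; apply: lt_le_trans (h i) _.
    by rewrite lef_pV2 ?posrE// ler_nat.
rewrite -(cvg_lim _ H)//; apply: lime_ge; first by apply/cvg_ex; eexists; exact: H.
apply: nearW => k; apply: config_gt0_ge1; [exact: measurable_cube|exact: bounded_cube|].
by apply: Sx; rewrite invr_gt0.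
Qed.

Lemma simple_supp Xi x : simple_config Xi -> supp Xi x -> Xi [set x] = 1%E.
Proof. by move=> sX /supp_point_ge1; case: (sX x) => ->//; rewrite lee_fin ler10. Qed.

Lemma config_seq Xi (s : seq T) : simple_config Xi -> uniq s ->
  (forall x, x \in s -> supp Xi x) -> measurable [set` s] /\ Xi [set` s] = (size s)%:R%:E.
Proof.
move=> sX; elim: s => [|x s IH] /=.
  move=> _ _; have -> : [set` [::]] = set0 :> set T by apply/seteqP; split.
  by split; [exact: measurable0|rewrite measure0].
move=> /andP[xs us] sS; have [|ms Xs] := IH us.
  by move=> y ys; apply: sS; rewrite inE ys orbT.
have -> : [set` x :: s] = [set x] `|` [set` s].
  apply/seteqP; split=> y /=; rewrite inE; first by move=> /orP[/eqP|]; [left|right].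
  by move=> [->|->]; rewrite ?eqxx ?orbT.
split; first by apply: measurableU => //; exact: measurable_point.
rewrite measureU//=; [|exact: measurable_point|].
  rewrite Xs simple_supp//; last by apply: sS; exact: mem_head.
  by rewrite -nat1r EFinD.
by apply/seteqP; split=> // y /= [->]; rewrite (negbTE xs).
Qed.

(* A point off the support lies in a null cube with rational centre and radius,
   and there are countably many of those. *)
Lemma config_off_supp Xi A : measurable A -> (forall x, A x -> ~ supp Xi x) -> Xi A = 0%E.
Proof.
move=> mA Asupp; pose rc (p : d.-tuple rat * rat) : set T :=
  cube [tuple ratr (tnth p.1 i) | i < d] (ratr p.2).
pose F n : set T := if unpickle n is Some p then
  (if Xi (rc p) == 0%E then rc p else set0) else set0.
have nF n : Xi.-negligible (F n).
  rewrite /F; case: unpickle => [p|]; last exact: negligible_set0.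
  case: eqP => [h|_]; last exact: negligible_set0.
  by apply/negligibleP => //; exact: measurable_cube.
apply/negligibleP => //; apply: negligibleS (negligible_bigcup nF) => x Ax.
have [e e0 Xe] : exists2 e : R, 0 < e & Xi (cube x e) = 0%E.
  have [e /not_implyP[e0 /negP]] := (existsNP _).2 (Asupp x Ax).
  rewrite -leNgt => h; exists e => //; apply/eqP.
  by rewrite eq_le h measure_ge0.
have e20 : 0 < e / 2 by rewrite divr_gt0.
(* With radius q < e/2 and a centre within q of x, the rational cube contains x and stays within 2q
   < e of it. *)
have [q /andP[q1 q2]] : exists q : rat, 0 < (ratr q : R) < e / 2.
  by have [q qI] := rat_in_itvoo e20; exists q; rewrite in_itv /= in qI.
have cq i : exists c : rat, `|tnth x i - ratr c| < (ratr q : R).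
  have h : tnth x i - ratr q < tnth x i + ratr q by rewrite ltrD2l gt0_cp.
  have [c] := rat_in_itvoo h.
  by rewrite in_itv /= => hc; exists c; rewrite distrC ltr_distl.
have [c cx] := choice cq.
pose p := ([tuple c i | i < d], q).
have px : rc p x by move=> i /=; rewrite !tnth_mktuple.
have pe : rc p `<=` cube x e.
  move=> y /= hy i; have := hy i; have := px i => /=; rewrite !tnth_mktuple => h1 h2.
  rewrite -(subrKA (ratr (c i))); apply: le_lt_trans (ler_normD _ _) _.
  by rewrite [X in _ + X]distrC (splitr e) ltrD// (lt_trans _ q2).
exists (pickle p) => //; rewrite /F pickleK ifT//; apply/eqP/le_anti.
rewrite measure_ge0 andbT -Xe; apply: le_measure => //; rewrite inE; exact: measurable_cube.
Qed.

(** If A has mass k, then k + 1 support points of mass 1 in A would be too many, so the support is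
    finite there; the rest of A lies off the support and is null. *)
Lemma config_enum Xi A : simple_config Xi -> measurable A -> bounded_subset A ->
  exists s : seq T, [/\ uniq s, forall x, x \in s <-> supp Xi x /\ A x & Xi A = (size s)%:R%:E].
Proof.
move=> sX mA bA; have [k Ak] := config_nat Xi mA bA.
have fin : finite_set (supp Xi `&` A).
  apply: contrapT => /(@infinite_set_fset _ _ k.+1)[B BS]; set s := finmap.enum_fset B => sk.
  have us : uniq s by exact: finmap.fset_uniq.
  have sB x : x \in s -> (supp Xi `&` A) x by move=> xs; apply: BS.
  have [ms Xs] := config_seq sX us (fun x xs => (sB x xs).1).
  have : (Xi [set` s] <= Xi A)%E.
    by apply: le_measure; rewrite ?inE// => x /= /sB[].
  by rewrite Xs Ak lee_fin ler_nat leqNgt sk.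
have [s us sE] : exists2 s : seq T, uniq s & [set` s] = supp Xi `&` A.
  have [s sE] := (finite_seqP _).1 fin; exists (undup s); first exact: undup_uniq.
  by rewrite sE; apply/seteqP; split => x /=; rewrite mem_undup.
have sP x : x \in s <-> supp Xi x /\ A x.
  by rewrite -[supp Xi x /\ A x]/((supp Xi `&` A) x) -sE.
exists s; split => //.
have [ms Xs] := config_seq sX us (fun x xs => ((sP x).1 xs).1).
have sA : [set` s] `<=` A by move=> x /= /sP[].
rewrite -Xs -(setDUK sA) measureU//; last 2 first.
- exact: measurableD.
- by apply/seteqP; split=> x //= [? []].
have Xn : Xi (A `\` [set` s]) = 0%E.
  apply: config_off_supp; first exact: measurableD.
  by move=> x [Ax nsx] Sx; apply: nsx; apply/sP.
exact: etrans (congr1 (fun u => (Xi [set` s] + u)%E) Xn) (adde0 _).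
Qed.

Lemma count_distinct1 Xi A : simple_config Xi -> measurable A -> bounded_subset A ->
  (\esum_(z in @distinct_points R d 1 Xi) (\1_A (tnth z ord0) : R)%:E = Xi A)%E.
Proof.
move=> sX mA bA; have [s [us sP ->]] := config_enum sX mA bA.
rewrite -(size_map (fun x => [tuple x] : 1.-tuple T)).
apply: esum_indicator_seq.
- by rewrite map_inj_uniq// => x y [].
- move=> z /mapP[x xs ->]; split => // i; rewrite (ord1 i).
  by have [] := (sP x).1 xs.
- move=> z [uz Sz]; rewrite indicE.
  have -> : (z \in [seq [tuple x] | x <- s]) = (tnth z ord0 \in A); last by case: (_ \in _).
  apply/mapP/idP => [[x xs ->]|]; first by rewrite inE; have [] := (sP x).1 xs.
  rewrite inE => zA; exists (tnth z ord0); first by apply/sP.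
  by apply: eq_from_tnth => i; rewrite (ord1 i) (tnth_nth (tnth z ord0)).
Qed.

Lemma count_distinct2 Xi A : simple_config Xi -> measurable A -> bounded_subset A ->
  (\esum_(z in @distinct_points R d 2 Xi)
     (\1_A (tnth z ord0) * \1_A (tnth z (lift ord0 ord0)) : R)%:E =
   Xi A * (Xi A - 1))%E.
Proof.
move=> sX mA bA; have [s [us sP ->]] := config_enum sX mA bA.
(* The ordered pairs of distinct support points in A, which number n (n - 1) for n points. *)
pose l := [seq ([tuple x; y] : 2.-tuple T) | x <- s, y <- rem x s].
have sl : size l = (size s * (size s).-1)%N.
  rewrite size_allpairs_dep.
  have -> : [seq size (rem x s) | x <- s] = [seq (size s).-1 | _ <- s].
    by apply/eq_in_map => x xs; rewrite size_rem.
  by elim: (s) ((size s).-1) => //= x s' IH n; rewrite IH mulSn.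
have -> : ((size s)%:R%:E * ((size s)%:R%:E - 1) = (size l)%:R%:E :> \bar R)%E.
  rewrite sl -EFinB -EFinM natrM; case: (size s) => [|n]; first by rewrite !mul0r.
  by rewrite -[X in _ - X]/(1%:R) -natrB// subn1.
apply: esum_indicator_seq.
- apply: allpairs_uniq_dep => //; first by move=> x _; exact: rem_uniq.
  by move=> [x y] [x' y'] _ _ /= [-> ->].
- move=> z /allpairsPdep[x [y [xs ys ->]]].
  move: ys; rewrite mem_rem_uniq// inE => /andP[yx ys]; split.
    by rewrite /= inE eq_sym yx.
  move=> i; rewrite (tnth_nth x); case: i => [[|[|//]] ?] /=.
    by have [] := (sP x).1 xs.
  by have [] := (sP y).1 ys.
- move=> z [uz Sz]; rewrite !indicE.
  set a := tnth z ord0; set b := tnth z (lift ord0 ord0).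
  have zE : z = [tuple a; b].
    apply: eq_from_tnth => i; rewrite [RHS](tnth_nth a); case: i => [[|[|//]] ?] /=;
      by congr tnth; exact: val_inj.
  have ab : b != a by move: uz; rewrite zE /= inE andbT eq_sym.
  have -> : (z \in l) = (a \in A) && (b \in A).
    apply/allpairsPdep/andP => [[x [y [xs ys]]]|].
      rewrite zE => /(congr1 val) /= [-> ->].
      move: ys; rewrite mem_rem_uniq// inE => /andP[yx ys].
      by rewrite !inE; split; [have [] := (sP x).1 xs|have [] := (sP y).1 ys].
    rewrite !inE => -[aA bA']; exists a, b; split => //.
      by apply/sP; split => //; exact: Sz.
    by rewrite mem_rem_uniq// inE ab; apply/sP; split => //; exact: Sz.
  by do 2 case: (_ \in A); rewrite ?mul1r ?mul0r.
Qed.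

End configurations.

(** * Almost sure properties of the coordinates of a tuple *)

Section tuple_ae.
Context {disp : measure_display} {T : measurableType disp} {R : realType}.
Variable m : {sigma_finite_measure set T -> \bar R}.

Lemma ae_tuple1 (Q : T -> Prop) : {ae m, forall x, Q x} ->
  {ae tuple_measure m 1, forall z, Q (tnth z ord0)}.
Proof.
move=> [N [mN N0 QN]].
have mB : measurable ((fun z : 1.-tuple T => tnth z ord0) @^-1` N).
  by rewrite -[X in measurable X]setTI; exact: measurable_tnth.
exists ((fun z : 1.-tuple T => tnth z ord0) @^-1` N); split => //; last by move=> z /= h; exact: QN.
rewrite -[X in tuple_measure m 1 X]setIT -integral_indic//.
rewrite (@ge0_integral_tuple1 _ _ _ m (fun x => (\1_N x)%:E))//.
- by rewrite integral_indic// setIT.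
- by apply/measurable_EFinP; exact: measurable_indic.
Qed.

Lemma ae_tuple2 (Q : T -> Prop) : {ae m, forall x, Q x} ->
  {ae tuple_measure m 2, forall z, Q (tnth z ord0) /\ Q (tnth z (lift ord0 ord0))}.
Proof.
move=> [N [mN N0 QN]].
have mI : measurable_fun setT (fun x => (\1_N x : R)%:E).
  by apply/measurable_EFinP; exact: measurable_indic.
have IN : (\int[m]_x (\1_N x)%:E = 0)%E by rewrite integral_indic// setIT.
have mB i : measurable ((fun z : 2.-tuple T => tnth z i) @^-1` N).
  by rewrite -[X in measurable X]setTI; exact: measurable_tnth.
have ae_coord i : tuple_measure m 2 ((fun z : 2.-tuple T => tnth z i) @^-1` N) = 0%E ->
    {ae tuple_measure m 2, forall z, Q (tnth z i)}.
  by move=> h; exists ((fun z : 2.-tuple T => tnth z i) @^-1` N); split => // z /= hz; exact: QN.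
have m1 : measurable_fun setT (fun p : T * T => (\1_N p.1 : R)%:E).
  exact: (measurableT_comp mI measurable_fst).
have m2 : measurable_fun setT (fun p : T * T => (\1_N p.2 : R)%:E).
  exact: (measurableT_comp mI measurable_snd).
have H0 : {ae tuple_measure m 2, forall z, Q (tnth z ord0)}.
  apply: ae_coord; rewrite -[X in tuple_measure m 2 X]setIT -integral_indic//.
  rewrite (@ge0_integral_tuple2 _ _ _ m (fun p => (\1_N p.1)%:E))//.
  (* Exchanging the order makes the null coordinate the inner one, so the total mass of the other
     coordinate never enters. *)
  rewrite (fubini_tonelli (fun p : T * T => (\1_N p.1)%:E))//=.
  by under eq_integral do rewrite IN; rewrite integral0.
have H1 : {ae tuple_measure m 2, forall z, Q (tnth z (lift ord0 ord0))}.
  apply: ae_coord; rewrite -[X in tuple_measure m 2 X]setIT -integral_indic//.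
  rewrite (@ge0_integral_tuple2 _ _ _ m (fun p => (\1_N p.2)%:E))//=.
  by under eq_integral do rewrite IN; rewrite integral0.
by apply: filterS2 H0 H1 => z; split.
Qed.

End tuple_ae.

Lemma det_mx2 {F : comPzRingType} (M : 'M[F]_2) :
  \det M = M 0 0 * M 1 1 - M 0 1 * M 1 0.
Proof.
rewrite (expand_det_row _ 0) !big_ord_recl big_ord0 addr0 /cofactor /=.
rewrite !det_mx11 !mxE /= /bump /= !expr0 expr1 mul1r mulN1r mulrN.
by congr (_ * M _ _ - M _ _ * M _ _); exact: val_inj.
Qed.

(** * Mean and variance of the number of points *)

Section moments.
Context {R : realType} {d : nat}.
Local Notation T := (euclid R d).
Local Notation mu := (leb R d).
Variables (Kop : operator R d) (L : set (T -> R[i])) (S0 : set T) (K : T -> T -> R[i]).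
Hypothesis hproj : orthogonal_projection Kop L.
Hypothesis hkernel : projection_kernel Kop L S0 K.
Hypothesis hdiag : {ae mu, forall x, K x x = 1}.
Variables (P : probability (config R d) R) (A : set T).
Hypothesis hP : determinantal_process P K.
Hypotheses (mA : measurable A) (bA : bounded_subset A).

Lemma measurable_config_eval : measurable_fun setT (fun Xi : config R d => Xi A).
Proof.
move=> _ Y mY; rewrite setTI; apply: sub_sigma_algebra.
by exists A; split => //; exists Y.
Qed.

Lemma count_inE (Xi : config R d) : (count_in A Xi)%:E = Xi A.
Proof. by rewrite /count_in fineK// ge0_fin_numE// config_fin. Qed.

Let mI : measurable_fun setT (\1_A : T -> R).
Proof. exact: measurable_indic. Qed.

Let mcoord n (i : 'I_n) : measurable_fun setT (fun z : n.-tuple T => tnth z i).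
Proof. exact: measurable_tnth. Qed.

Let mKc n (i j : 'I_n) : cmeasurable (fun z : n.-tuple T => K (tnth z i) (tnth z j)).
Proof.
have h : measurable_fun setT (fun z : n.-tuple T => (tnth z i, tnth z j)).
  by apply: measurable_fun_pair; exact: mcoord.
exact: (cmeasurable_comp h (kernel_measurable hkernel)).
Qed.

Lemma measurable_count_in : measurable_fun setT (count_in A : config R d -> R).
Proof. exact: measurableT_comp measurable_config_eval. Qed.

Lemma count_in_ge0 (Xi : config R d) : 0 <= count_in A Xi.
Proof. by rewrite /count_in fine_ge0. Qed.

Lemma config_falling_ge0 (Xi : config R d) : (0 <= Xi A * (Xi A - 1))%E.
Proof.
have [k ->] := config_nat Xi mA bA; rewrite -EFinB -EFinM lee_fin.
by case: k => [|k]; rewrite ?mul0r// mulr_ge0// subr_ge0 ler1n.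
Qed.

Lemma measurable_config_falling :
  measurable_fun setT (fun Xi : config R d => (Xi A * (Xi A - 1))%E).
Proof.
apply: emeasurable_funM; first exact: measurable_config_eval.
by apply: emeasurable_funB => //; exact: measurable_config_eval.
Qed.

Lemma leb_fin : mu A \is a fin_num.
Proof. by rewrite ge0_fin_numE// leb_bounded_lty. Qed.

Lemma pair_mass_fin : pair_mass K A \is a fin_num.
Proof.
rewrite ge0_fin_numE ?pair_mass_ge0//.
apply: le_lt_trans (pair_mass_le hproj hkernel hdiag mA) _.
exact: leb_bounded_lty.
Qed.

Lemma expectation_count : (\int[P]_Xi (Xi A) = mu A)%E.
Proof.
have [sP corr] := hP.
pose f (z : 1.-tuple T) : R := \1_A (tnth z ord0).
have mf : measurable_fun setT f by exact: (measurableT_comp mI (mcoord ord0)).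
have f0 z : 0 <= f z by rewrite /f indicE.
have fB : exists2 B : set T, bounded_subset B & forall z : 1.-tuple T, (exists i, ~ B (tnth z i)) -> f z = 0.
  by exists A => // z [j]; rewrite (ord1 j) => nA; rewrite /f indicE memNset.
have EP : (\int[P]_Xi (\esum_(z in @distinct_points R d 1 Xi) (f z)%:E) = \int[P]_Xi (Xi A))%E.
  apply: ge0_ae_integral.
  - by move=> Xi; apply: esum_ge0 => z _; rewrite lee_fin.
  - by move=> Xi; exact: measure_ge0.
  - exact: measurable_config_eval.
  - by apply: filterS sP => Xi sX _; exact: count_distinct1.
rewrite -EP (corr 1%N f mf f0 fB).
transitivity (\int[tuple_measure mu 1]_z (\1_A (tnth z ord0) : R)%:E)%E.
  have mf' : measurable_fun setT (EFin \o f) by exact/measurable_EFinP.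
  apply: ae_eq_integral => //.
    apply/measurable_EFinP; apply: measurable_funM => //.
    by under eq_fun do rewrite det_mx11 mxE; exact: (mKc ord0 ord0).1.
  apply: filterS (ae_tuple1 hdiag) => z Kz _.
  by rewrite det_mx11 mxE Kz /= mulr1.
rewrite (@ge0_integral_tuple1 _ _ _ mu (fun x => (\1_A x)%:E))//.
  by rewrite integral_indic// setIT.
exact/measurable_EFinP.
Qed.

Let z0 (z : 2.-tuple T) := tnth z ord0.
Let z1 (z : 2.-tuple T) := tnth z (lift ord0 ord0).

Lemma ae_section_unit : {ae mu, forall x, [/\ S0 x, K x x = 1 & nn (K ^~ x) = 1]}.
Proof.
apply: filterS3 (ae_S0 hkernel) hdiag (ae_nn_section hproj hkernel hdiag) => x h1 h2 h3.
by split.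
Qed.

(** Cauchy-Schwarz for K(y,x) = <K_x, K_y>, obtained as Bessel for the single unit vector K_y. *)
Lemma sqn_kernel_le1 x y : S0 x -> S0 y -> nn (K ^~ x) = 1 -> nn (K ^~ y) = 1 ->
  sqn (K y x) <= 1.
Proof.
move=> Sx Sy nx ny; rewrite (kernel_inner hkernel Sx Sy).
have Lx := L2_section hproj hkernel Sx; have Ly := L2_section hproj hkernel Sy.
have := @Bessel R d (fun=> K ^~ y) (fun=> 1) (fun=> Ly) [:: 0%N] (K ^~ x) Lx isT.
rewrite big_seq1 nx; apply => [i j|//]; rewrite !inE => /eqP -> /eqP ->.
by rewrite eqxx inner_diag// -/(nn _) ny.
Qed.

(** The second correlation function is 1 - |K|^2 almost everywhere, the determinant of a Hermitian
    matrix with unit diagonal. Sums over distinct pairs produce the factorial moment rather than the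
    square. *)
Lemma second_factorial_moment :
  (\int[P]_Xi (Xi A * (Xi A - 1)) + pair_mass K A = mu A * mu A)%E.
Proof.
have [sP corr] := hP.
pose f (z : 2.-tuple T) : R := \1_A (z0 z) * \1_A (z1 z).
have mf : measurable_fun setT f.
  by apply: measurable_funM; apply: (measurableT_comp mI); exact: mcoord.
have f0 z : 0 <= f z by rewrite /f !indicE mulr_ge0.
have fB : exists2 B : set T, bounded_subset B & forall z : 2.-tuple T, (exists i, ~ B (tnth z i)) -> f z = 0.
  exists A => // z [j]; rewrite /f !indicE.
  have [->|->] : j = ord0 \/ j = lift ord0 ord0.
  - by case: j => [[|[|//]] ?]; [left|right]; exact: val_inj.
  - by move=> nA; rewrite (memNset nA) mul0r.
  - by move=> nA; rewrite (memNset nA) mulr0.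
pose F z : R := f z * (1 - sqn (K (z1 z) (z0 z))).
pose G z : R := f z * sqn (K (z1 z) (z0 z)).
have mKz : measurable_fun setT (fun z => sqn (K (z1 z) (z0 z))).
  exact/measurable_sqn/mKc.
have mG : measurable_fun setT G by exact: measurable_funM.
have mF : measurable_fun setT F.
  by apply: measurable_funM => //; apply: measurable_funB.
have G0 z : 0 <= G z by rewrite mulr_ge0 ?sqn_ge0.
(* [F] is nonnegative only almost everywhere; its positive part is so at every point, as the
   integrals of nonnegative functions require. *)
pose F' z : R := Num.max 0 (F z).
have mF' : measurable_fun setT F' by exact: measurable_maxr.
have F'0 z : 0 <= F' z by rewrite /F' le_max lexx.
have unit2 := ae_tuple2 ae_section_unit.
have EF : (\int[P]_Xi (Xi A * (Xi A - 1)) = \int[tuple_measure mu 2]_z (F' z)%:E)%E.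
  have EP : (\int[P]_Xi (\esum_(z in @distinct_points R d 2 Xi) (f z)%:E) =
      \int[P]_Xi (Xi A * (Xi A - 1)))%E.
    apply: ge0_ae_integral.
    - by move=> Xi; apply: esum_ge0 => z _; rewrite lee_fin.
    - exact: config_falling_ge0.
    - exact: measurable_config_falling.
    - by apply: filterS sP => Xi sX _; exact: count_distinct2.
  rewrite -EP (corr 2%N f mf f0 fB).
  apply: ae_eq_integral => //.
  - apply/measurable_EFinP; apply: measurable_funM => //.
    under eq_fun do rewrite det_mx2 !mxE.
    have h := cmeasurableM (mKc (n := 2) 0 0) (mKc 1 1).
    have h' := cmeasurableM (mKc (n := 2) 0 1) (mKc 1 0).
    have E (u v : R[i]) : complex.Re (u - v) = complex.Re u - complex.Re v.
      by case: u v => ? ? [].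
    under eq_fun do rewrite E; apply: measurable_funB; [exact: h.1|exact: h'.1].
  - exact/measurable_EFinP.
  apply: filterS unit2 => z [[S0z K0 n0] [S1z K1 n1]] _; congr _%:E.
  have -> : complex.Re (\det (\matrix_(i, j) K (tnth z i) (tnth z j))) = 1 - sqn (K (z1 z) (z0 z)).
    rewrite det_mx2 !mxE.
    have -> : (1 : 'I_2) = lift ord0 ord0 by exact: val_inj.
    rewrite K0 K1 (kernel_hermitian hproj hkernel S0z S1z) mul1r mulrC mul_conjc.
    by [].
  rewrite /F' /F max_r// mulr_ge0// subr_ge0.
  exact: sqn_kernel_le1.
have EG : (pair_mass K A = \int[tuple_measure mu 2]_z (G z)%:E)%E.
  rewrite (@ge0_integral_tuple2 _ _ _ mu
    (fun p => (\1_A p.1 * \1_A p.2 * sqn (K p.2 p.1))%:E)); last 2 first.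
  - apply/measurable_EFinP; apply: measurable_funM.
      by apply: measurable_funM; apply: (measurableT_comp mI).
    have sw : measurable_fun setT (fun p : T * T => (p.2, p.1)).
      exact: measurable_fun_pair measurable_snd measurable_fst.
    exact: (measurable_sqn (cmeasurable_comp sw (kernel_measurable hkernel))).
  - by move=> p; rewrite lee_fin mulr_ge0 ?sqn_ge0// !indicE mulr_ge0.
  apply: eq_integral => x _; rewrite section_massE -ge0_integralZl_EFin//; last 2 first.
  - by move=> y _; rewrite lee_fin mulr_ge0 ?sqn_ge0// indicE.
  - exact: (measurableT_comp (measurable_kernel_weight hkernel mA) (pair1_measurable x)).
  by apply: eq_integral => y _; rewrite -EFinM mulrA.
have EA : (mu A * mu A = \int[tuple_measure mu 2]_z (f z)%:E)%E.
  rewrite (@ge0_integral_tuple2 _ _ _ mu (fun p => (\1_A p.1 * \1_A p.2)%:E)); last 2 first.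
  - apply/measurable_EFinP.
    by apply: measurable_funM; apply: (measurableT_comp mI).
  - by move=> p; rewrite lee_fin !indicE mulr_ge0.
  have IA : (\int[mu]_x (\1_A x)%:E = mu A)%E by rewrite integral_indic// setIT.
  have mIE : measurable_fun setT (fun x => (\1_A x : R)%:E) by exact/measurable_EFinP.
  transitivity (\int[mu]_x ((\1_A x)%:E * mu A))%E.
    by rewrite ge0_integralZr// ?IA// => x _; rewrite lee_fin indicE.
  by apply: eq_integral => x _; rewrite -IA -ge0_integralZl_EFin.
rewrite EF EG EA -ge0_integralD//; last 4 first.
- by move=> z _; rewrite lee_fin.
- exact/measurable_EFinP.
- by move=> z _; rewrite lee_fin.
- exact/measurable_EFinP.
apply: ge0_ae_eq_integral => //.
- by apply: emeasurable_funD; exact/measurable_EFinP.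
- exact/measurable_EFinP.
- by move=> z _; rewrite -EFinD lee_fin addr_ge0.
- by move=> z _; rewrite lee_fin.
apply: filterS unit2 => z [[S0z _ n0] [S1z _ n1]] _; rewrite -EFinD; congr _%:E.
rewrite /F' max_r; first by rewrite /F /G; ring.
by rewrite /F mulr_ge0// subr_ge0; exact: sqn_kernel_le1.
Qed.

Lemma expectation_count_in : ('E_P[count_in A] = mu A)%E.
Proof.
by rewrite unlock -expectation_count; apply: eq_integral => Xi _; exact: count_inE.
Qed.

(** X^2 = X (X - 1) + X; finiteness of [pair_mass] allows the subtraction. *)
Lemma second_moment :
  (\int[P]_Xi ((count_in A Xi) ^+ 2)%:E = mu A * mu A - pair_mass K A + mu A)%E.
Proof.
rewrite -second_factorial_moment addeK ?pair_mass_fin//.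
rewrite -expectation_count -ge0_integralD//; last 3 first.
- by move=> Xi _; exact: config_falling_ge0.
- exact: measurable_config_falling.
- exact: measurable_config_eval.
apply: eq_integral => Xi _; rewrite -count_inE -EFinB -EFinM -EFinD; congr _%:E; ring.
Qed.

Lemma variance_count_in : ('V_P[count_in A] = mu A - pair_mass K A)%E.
Proof.
have muAf := leb_fin; have pA := pair_mass_fin.
(* Square integrability, which the expansion of the variance requires, follows from the finite
   second moment. *)
have X2 : count_in A \in Lfun P 2.
  rewrite inE; apply/andP; split; rewrite inE/=; first exact: measurable_count_in.
  rewrite /finite_norm unlock poweR_lty//.
  rewrite (_ : (\int[P]_x _)%E = (\int[P]_Xi ((count_in A Xi) ^+ 2)%:E)%E).
    rewrite second_moment -(fineK muAf) -(fineK pA); exact: ltry.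
  apply: eq_integral => Xi _.
  by rewrite abse_EFin poweR_EFin powR_mulrn// ger0_norm// count_in_ge0.
rewrite varianceE// expectation_count_in.
have -> : ('E_P[(count_in A ^+ 2)%R] = mu A * mu A - pair_mass K A + mu A)%E.
  by rewrite -second_moment unlock; apply: eq_integral => Xi _.
rewrite expe2 -(fineK muAf) -(fineK pA) -EFinM -!(EFinD, EFinN).
congr _%:E; ring.
Qed.

End moments.

(** * Convergence of the accumulated spectrogram *)

Lemma indic_dilate {R : realType} {d : nat} (r : R) (A : set (euclid R d)) x :
  r != 0 -> \1_(dilate r A) (scale r x) = \1_A x :> R.
Proof.
move=> r0; rewrite !indicE; congr (_%:R); congr nat_of_bool.
by apply/idP/idP; rewrite !inE dilateE//= scaleK.
Qed.

Unset Implicit Arguments.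

Theorem corollary1p3 (R : realType) (d : nat) (hd : (0 < d)%N)
    (Lambda : set (euclid R d))
    (mLambda : measurable Lambda) (bLambda : bounded_subset Lambda)
    (Kop : operator R d) (L : set (euclid R d -> R[i]))
    (S0 : set (euclid R d)) (K : euclid R d -> euclid R d -> R[i])
    (hproj : orthogonal_projection Kop L)
    (htrace : locally_trace_class Kop)
    (hkernel : projection_kernel Kop L S0 K)
    (P : probability (config R d) R)
    (hP : determinantal_process P K)
    (hyper : hyperuniform P Lambda)
    (hdiag : {ae leb R d, forall x, K x x = 1})
    (rho : R -> euclid R d -> R)
    (hrho : forall r, 0 < r ->
       acc_spectrogram Kop L (dilate r Lambda) (rho r)) :
  cvg_in_L1 (fun r x => rho r (scale r x)) (\1_Lambda).
Proof.
have mA r : 0 < r -> measurable (dilate r Lambda).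
  by move=> r0; apply: measurable_dilate; rewrite ?gt_eqF.
have bA r := bounded_dilate r bLambda.
have HE r (r0 : 0 < r) := expectation_count_in hkernel hdiag hP (mA r r0) (bA r).
have HV r (r0 : 0 < r) := variance_count_in hproj hkernel hdiag hP (mA r r0) (bA r).
have HD r (r0 : 0 < r) := acc_spectrogram_L1 hproj hkernel hdiag (mA r r0) (hrho r r0).
have lam_fin := leb_fin mLambda bLambda.
set lam := fine (leb R d Lambda).
have lamE : leb R d Lambda = lam%:E by rewrite fineK.
pose e (r : R) : R := r ^+ d * lam.
pose v (r : R) : R := fine ('V_P[count_in (dilate r Lambda)]).
have Ee r : 0 < r -> ('E_P[count_in (dilate r Lambda)] = (e r)%:E)%E.
  by move=> r0; rewrite HE// leb_dilate// lamE.
have Vv r : 0 < r -> ('V_P[count_in (dilate r Lambda)] = (v r)%:E)%E.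
  move=> r0; rewrite /v fineK// HV// fin_numB (leb_fin (mA r r0) (bA r)) /=.
  exact: (pair_mass_fin hproj hkernel hdiag (mA r r0) (bA r)).
have pos : \forall r \near +oo, (0 : R) < r by exact: nbhs_pinfty_gt.
have e_pinfty : e r @[r --> +oo] --> +oo.
  apply/cvgeryP; apply: cvg_trans hyper.1; apply: near_eq_cvg.
  by apply: filterS pos => r r0; rewrite Ee.
have e_gt0 : \forall r \near +oo, (0 : R) < e r.
  by move/cvgryPgt : e_pinfty; exact.
have ve0 : v r / e r @[r --> +oo] --> 0.
  have c : (v r / e r)%:E @[r --> +oo] --> 0%E.
    apply: cvg_trans hyper.2; apply: near_eq_cvg.
    by apply: filterS2 pos e_gt0 => r r0 er0; rewrite Ee// Vv// inver gt_eqF.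
  exact: (fine_cvg c).
have eV0 : (e r)^-1 @[r --> +oo] --> 0 by apply/gtr0_cvgV0.
have scaled r (g : euclid R d -> \bar R) := @ge0_integral_leb_scale R d r g.
have sE r (r0 : 0 < r) x : \1_Lambda x = \1_(dilate r Lambda) (scale r x) :> R.
  by rewrite indic_dilate// gt_eqF.
have mS r := @measurable_scale R d r.
split.
- move=> r r0; have [mr /integrableP[mr' ir] _] := HD r r0.
  have m' : measurable_fun setT (fun x => (rho r (scale r x))%:E).
    exact: (measurableT_comp mr' (mS r)).
  apply/integrableP; split => //.
  have := scaled r (fun x => `|(rho r x)%:E|)%E r0 _ _.
  move=> -> //; last exact: measurableT_comp.
  by apply: lte_mul_pinfty => //; rewrite lee_fin invr_ge0 exprn_ge0// ltW.
- apply/integrableP; split; first by apply/measurable_EFinP; exact: measurable_indic.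
  under eq_integral do rewrite /= ger0_norm ?indicE// -indicE.
  by rewrite integral_indic// setIT; exact: leb_bounded_lty.
(* The bound r^-d (2 Var + 1), rewritten with r^-d = lam / e r. *)
- pose h r := (lam * (2 * (v r / e r) + (e r)^-1))%:E.
  have h0 : h r @[r --> +oo] --> 0%E.
    apply: cvg_EFin; first exact: nearW.
    rewrite -[X in _ --> X](mulr0 lam); apply: cvgM; first exact: cvg_cst.
    rewrite -[X in _ --> X](addr0 0); apply: cvgD => //.
    by rewrite -[X in _ --> X](mulr0 2); apply: cvgM => //; exact: cvg_cst.
  apply: (squeeze_cvge _ (cvg_cst 0%E) h0).
  apply: filterS2 pos e_gt0 => r r0 er0; rewrite Lnorm_ge0 Lnorm1 /=.
  have [mr _ Dr] := HD r r0.
  under eq_integral do rewrite (sE r r0).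
  have mD : measurable_fun setT (fun x => `|(rho r x - \1_(dilate r Lambda) x)%:E|)%E.
    apply: measurableT_comp => //; apply/measurable_EFinP; apply: measurable_funB => //.
    by apply: measurable_indic; exact: mA.
  rewrite (scaled r (fun x => `|(rho r x - \1_(dilate r Lambda) x)%:E|)%E r0 mD)//.
  have rd0 : 0 < r ^+ d by rewrite exprn_gt0.
  (* Positivity of the volume comes from hyperuniformity: the expected counts r^d lam diverge. *)
  have lam0 : lam != 0 by apply: contraTneq er0 => l0; rewrite /e l0 mulr0 ltxx.
  apply: (@le_trans _ _ ((r ^- d)%:E * (2 * v r + 1)%:E)%E).
    apply: lee_wpmul2l; first by rewrite lee_fin invr_ge0 ltW.
    by apply: le_trans Dr _; rewrite -HV// Vv// -EFinM -EFinD.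
  rewrite -EFinM lee_fin /e le_eqVlt; apply/orP; left; apply/eqP.
  by field; rewrite lam0 gt_eqF.
Qed.
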